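(* Let $\chi^{(1)}:X(\mathfrak{o}_4)\to Y(\mathfrak{sl}_2)\otimes Y(\mathfrak{gl}_2)$ and $\chi^{(2)}:X(\mathfrak{o}_4)\to Y(\mathfrak{gl}_2)\otimes Y(\mathfrak{sl}_2)$ be the algebra isomorphisms obtained from the embedding $\psi:X(\mathfrak{o}_4)\hookrightarrow Y(\mathfrak{gl}_2)\otimes Y(\mathfrak{gl}_2)$ (defined in the context) by composing it with the natural projection $Y(\mathfrak{gl}_2)\to Y(\mathfrak{sl}_2)$, $T_{ij}(u)\mapsto\mathcal T_{ij}(u)$, applied to the first, respectively second, tensor factor. The restriction of each of the isomorphisms $\chi^{(1)}$ and $\chi^{(2)}$ to the subalgebra $Y(\mathfrak{o}_4)$ induces an isomorphism $Y(\mathfrak{o}_4)\to Y(\mathfrak{sl}_2)\otimes Y(\mathfrak{sl}_2)$.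
   Context: Ground field $\mathbb C$. The extended Yangian $X(\mathfrak{o}_4)$ is the unital associative algebra with generators $t_{ij}^{(r)}$ ($i,j\in\{-2,-1,1,2\}$, $r\ge1$) and, with $t_{ij}(u)=\delta_{ij}+\sum_{r\ge1}t_{ij}^{(r)}u^{-r}$ and $\kappa=1$, defining relations (understood after multiplying by $(u-v)(u-v-\kappa)$) $$[t_{ij}(u),t_{kl}(v)]=\frac{1}{u-v}\big(t_{kj}(u)t_{il}(v)-t_{kj}(v)t_{il}(u)\big)-\frac{1}{u-v-\kappa}\Big(\delta_{k,-i}\sum_{p}t_{pj}(u)t_{-p,l}(v)-\delta_{l,-j}\sum_{p}t_{k,-p}(v)t_{ip}(u)\Big),$$ sums over $p\in\{-2,-1,1,2\}$. The Yangian $Y(\mathfrak{o}_4)$ is the subalgebra of $X(\mathfrak{o}_4)$ of elements fixed by all automorphisms $t_{ij}(u)\mapsto f(u)t_{ij}(u)$, $f(u)\in1+u^{-1}\mathbb C[[u^{-1}]]$. The Yangian $Y(\mathfrak{gl}_2)$ is the unital associative algebra with generators $T_{ij}^{(r)}$ ($i,j\in\{1,2\}$, $r\ge1$) and, with $T_{ij}(u)=\delta_{ij}+\sum_{r\ge1}T_{ij}^{(r)}u^{-r}$, defining relations $(u-v)[T_{ij}(u),T_{kl}(v)]=T_{kj}(u)T_{il}(v)-T_{kj}(v)T_{il}(u)$. The Yangian $Y(\mathfrak{sl}_2)$ is the subalgebra of $Y(\mathfrak{gl}_2)$ of elements fixed by all automorphisms $T_{ij}(u)\mapsto g(u)T_{ij}(u)$,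 $g(u)\in1+u^{-1}\mathbb C[[u^{-1}]]$. The quantum determinant $D(u)=T_{11}(u)T_{22}(u-1)-T_{21}(u)T_{12}(u-1)$ has central coefficients; define $d(u)\in1+u^{-1}Y(\mathfrak{gl}_2)[[u^{-1}]]$ (central coefficients) by $d(u)d(u-1)=D(u)$, and $\mathcal T_{ij}(u)=d(u)^{-1}T_{ij}(u)$. The coefficients of the $\mathcal T_{ij}(u)$ lie in $Y(\mathfrak{sl}_2)$, and $T_{ij}(u)\mapsto\mathcal T_{ij}(u)$ defines an algebra homomorphism $Y(\mathfrak{gl}_2)\to Y(\mathfrak{sl}_2)$ (the natural projection, with kernel the ideal generated by the nonconstant coefficients of $D(u)$). In $Y(\mathfrak{gl}_2)\otimes Y(\mathfrak{gl}_2)$ denote the generating series of the two copies by $T_{ij}(u)$ and $T'_{ij}(u)$. Encode indices by pairs $-2\leftrightarrow(1,1)$, $-1\leftrightarrow(1,2)$, $1\leftrightarrow(2,1)$, $2\leftrightarrow(2,2)$ and put $\varepsilon_{-2}=\varepsilon_{-1}=\varepsilon_1=1$, $\varepsilon_2=-1$. The embedding $\psi$ is given, for $a\leftrightarrow(i,j)$ and $b\leftrightarrow(k,l)$, by $\psi:t_{ab}(u)\mapsto\varepsilon_a\varepsilon_bT_{ik}(u)T'_{jl}(u)$. *)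

(* Defs.v *)
From HB Require Import structures.
From mathcomp Require Import all_boot all_order all_algebra.
From mathcomp Require Import generic_quotient.
From mathcomp Require Import complex.
From mathcomp Require Import boolp classical_sets reals.
From mathcomp Require Import finmap monalg.

Set Implicit Arguments.
Unset Strict Implicit.
Unset Printing Implicit Defensive.

Import Order.TTheory GRing.Theory.
Local Open Scope ring_scope.
Local Open Scope quotient_scope.
Local Open Scope classical_set_scope.

Section TwoSidedIdeal.
Variables (K : fieldType) (A : algType K).

(* Closure under scaling and opposite follows from the last clause.           *)
Definition two_sided_ideal (J : set A) : Prop :=
  [/\ J 0, forall x y, J x -> J y -> J (x + y)
         & forall a x b, J x -> J (a * x * b)].

Definition ideal_gen (S : set A) : set A := smallest two_sided_ideal S.

Lemma ideal_genP (S : set A) : two_sided_ideal (ideal_gen S).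
Proof.
split=> [J [[]]//|x y Sx Sy J JS|a x b Sx J JS].
- by case: (JS) => -[_ JD _] _; apply: JD; [apply: Sx | apply: Sy].
- by case: (JS) => -[_ _ JM] _; apply: JM; apply: Sx.
Qed.

(* [algType] requires 1 != 0, so only proper ideals are quotiented by.        *)
Record relators := Relators {
  relset :> set A;
  relset_proper : ~ ideal_gen relset 1 }.

End TwoSidedIdeal.

Section AlgQuotient.
Variables (K : fieldType) (A : algType K) (S : relators A).

Let J := ideal_gen S.
Let J0 : J 0. Proof. by case: (ideal_genP S). Qed.
Let JD x y : J x -> J y -> J (x + y).
Proof. by case: (ideal_genP S) => _ + _; apply. Qed.
Let JMl a x : J x -> J (a * x).
Proof.
by move=> Jx; rewrite -[a * x]mulr1; case: (ideal_genP S) => _ _; apply.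
Qed.
Let JMr b x : J x -> J (x * b).
Proof. by move=> Jx; rewrite -[x]mul1r; case: (ideal_genP S) => _ _; apply. Qed.
Let JZ c x : J x -> J (c *: x).
Proof. by move=> Jx; rewrite -[x]mul1r scalerAl; apply: JMl. Qed.
Let JN x : J x -> J (- x).
Proof. by move=> Jx; rewrite -scaleN1r; apply: JZ. Qed.

Definition cong (x y : A) : bool := `[< ideal_gen S (x - y) >].

Lemma cong_equiv : equiv_class_of cong.
Proof.
split=> [x|x y|y x z].
- by apply/asboolP; rewrite subrr.
- by apply/asboolP/asboolP => /JN; rewrite opprB.
- move=> /asboolP xy /asboolP yz; apply/asboolP.
  by rewrite -(subrK y x) -addrA; apply: JD.
Qed.
Canonical cong_equivRel := EquivRelPack cong_equiv.

Definition alg_quot : Type := {eq_quot cong}.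
HB.instance Definition _ := Choice.on alg_quot.
HB.instance Definition _ := EqQuotient.on alg_quot.

Notation pi := (\pi_alg_quot).

Lemma quot_eqP x y : pi x = pi y <-> ideal_gen S (x - y).
Proof. by split=> [/eqmodP/asboolP //|xy]; apply/eqmodP/asboolP. Qed.

Lemma quot_ind (P : alg_quot -> Prop) :
  (forall x, P (pi x)) -> forall x, P x.
Proof. by move=> Ppi x; rewrite -[x]reprK. Qed.

Let reprB x : J (repr (pi x) - x).
Proof. by apply/quot_eqP; rewrite reprK. Qed.

Definition quot_opp (x : alg_quot) : alg_quot := pi (- repr x).
Definition quot_add (x y : alg_quot) : alg_quot := pi (repr x + repr y).
Definition quot_mul (x y : alg_quot) : alg_quot := pi (repr x * repr y).
Definition quot_scale c (x : alg_quot) : alg_quot := pi (c *: repr x).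

Let oppE x : quot_opp (pi x) = pi (- x).
Proof. by apply/quot_eqP; rewrite -opprD; (apply: JN; apply: reprB). Qed.
Let addE x y : quot_add (pi x) (pi y) = pi (x + y).
Proof. by apply/quot_eqP; rewrite opprD addrACA; apply: JD; apply: reprB. Qed.
Let mulE x y : quot_mul (pi x) (pi y) = pi (x * y).
Proof.
apply/quot_eqP; set x' := repr _; set y' := repr _.
have -> : x' * y' - x * y = x' * (y' - y) + (x' - x) * y.
  by rewrite mulrBr mulrBl addrA subrK.
by apply: JD; [(apply: JMl; apply: reprB) | (apply: JMr; apply: reprB)].
Qed.
Let scaleE c x : quot_scale c (pi x) = pi (c *: x).
Proof. by apply/quot_eqP; rewrite -scalerBr; (apply: JZ; apply: reprB). Qed.

Let quot_addA : associative quot_add.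
Proof.
move=> x y z; elim/quot_ind: x => x; elim/quot_ind: y => y.
by elim/quot_ind: z => z; rewrite !addE addrA.
Qed.
Let quot_addC : commutative quot_add.
Proof.
move=> x y; elim/quot_ind: x => x; elim/quot_ind: y => y.
by rewrite !addE addrC.
Qed.
Let quot_add0 : left_id (pi 0) quot_add.
Proof. by move=> x; elim/quot_ind: x => x; rewrite addE add0r. Qed.
Let quot_addN : left_inverse (pi 0) quot_opp quot_add.
Proof. by move=> x; elim/quot_ind: x => x; rewrite oppE addE addNr. Qed.
HB.instance Definition _ := GRing.isZmodule.Build alg_quot
  quot_addA quot_addC quot_add0 quot_addN.

Let quot_mulA : associative quot_mul.
Proof.
move=> x y z; elim/quot_ind: x => x; elim/quot_ind: y => y.
by elim/quot_ind: z => z; rewrite !mulE mulrA.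
Qed.
Let quot_mul1 : left_id (pi 1) quot_mul.
Proof. by move=> x; elim/quot_ind: x => x; rewrite mulE mul1r. Qed.
Let quot_mulr1 : right_id (pi 1) quot_mul.
Proof. by move=> x; elim/quot_ind: x => x; rewrite mulE mulr1. Qed.
Let quot_mulDl : left_distributive quot_mul quot_add.
Proof.
move=> x y z; elim/quot_ind: x => x; elim/quot_ind: y => y.
by elim/quot_ind: z => z; rewrite !(mulE, addE) mulrDl.
Qed.
Let quot_mulDr : right_distributive quot_mul quot_add.
Proof.
move=> x y z; elim/quot_ind: x => x; elim/quot_ind: y => y.
by elim/quot_ind: z => z; rewrite !(mulE, addE) mulrDr.
Qed.
Let quot_10 : pi 1 != pi 0.
Proof. by apply/eqP => /quot_eqP; rewrite subr0; apply: relset_proper. Qed.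
HB.instance Definition _ := GRing.Zmodule_isNzRing.Build alg_quot
  quot_mulA quot_mul1 quot_mulr1 quot_mulDl quot_mulDr quot_10.

Let quot_scaleA a b x : quot_scale a (quot_scale b x) = quot_scale (a * b) x.
Proof. by elim/quot_ind: x => x; rewrite !scaleE scalerA. Qed.
Let quot_scale1 : left_id 1 quot_scale.
Proof. by move=> x; elim/quot_ind: x => x; rewrite scaleE scale1r. Qed.
Let piD x y : pi x + pi y = pi (x + y). Proof. exact: addE. Qed.
Let quot_scaleDr : right_distributive quot_scale +%R.
Proof.
move=> c x y; elim/quot_ind: x => x; elim/quot_ind: y => y.
by rewrite !(piD, scaleE) scalerDr.
Qed.
Let quot_scaleDl x : {morph quot_scale^~ x : a b / a + b}.
Proof. by move=> a b; elim/quot_ind: x => x; rewrite !scaleE scalerDl piD. Qed.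
HB.instance Definition _ := GRing.Zmodule_isLmodule.Build K alg_quot
  quot_scaleA quot_scale1 quot_scaleDr quot_scaleDl.

Let piM x y : pi x * pi y = pi (x * y). Proof. exact: mulE. Qed.
Let piZ c x : c *: pi x = pi (c *: x). Proof. exact: scaleE. Qed.
Let quot_scaleAl a (x y : alg_quot) : a *: (x * y) = a *: x * y.
Proof.
elim/quot_ind: x => x; elim/quot_ind: y => y.
by rewrite !(piM, piZ) scalerAl.
Qed.
Let quot_scaleAr a (x y : alg_quot) : a *: (x * y) = x * (a *: y).
Proof.
elim/quot_ind: x => x; elim/quot_ind: y => y.
by rewrite !(piM, piZ) scalerAr.
Qed.
HB.instance Definition _ :=
  GRing.Lmodule_isLalgebra.Build K alg_quot quot_scaleAl.
HB.instance Definition _ :=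
  GRing.Lalgebra_isAlgebra.Build K alg_quot quot_scaleAr.

Definition quot_proj (x : A) : alg_quot := pi x.

Lemma quot_proj_linear : linear quot_proj.
Proof. by move=> c x y; rewrite /quot_proj piZ piD. Qed.
Lemma quot_proj_monoid : monoid_morphism quot_proj.
Proof. by split=> [|x y]; rewrite /quot_proj ?piM. Qed.
HB.instance Definition _ := GRing.isLinear.Build K A alg_quot _ quot_proj
  quot_proj_linear.
HB.instance Definition _ := GRing.isMonoidMorphism.Build A alg_quot quot_proj
  quot_proj_monoid.

Lemma quot_proj_surj (x : alg_quot) : exists y, quot_proj y = x.
Proof. by exists (repr x); apply: reprK. Qed.
Lemma quot_proj_eq0 x : quot_proj x = 0 <-> ideal_gen S x.
Proof. by rewrite -[x in ideal_gen S x]subr0; apply: quot_eqP. Qed.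

End AlgQuotient.

Section FreeAlgebra.
Variables (K : fieldType) (I : choiceType).

Definition free_alg_type : Type := {malg K[{fmonom I}]}.
HB.instance Definition _ := GRing.Lalgebra.on free_alg_type.

Let free_scaleAr c (x y : free_alg_type) : c *: (x * y) = x * (c *: y).
Proof.
apply/malgP => m; rewrite mcoeffZ.
rewrite (mcoeffMlw _ (fsubset_refl _) (fsubset_refl _)).
rewrite (mcoeffMlw _ (fsubset_refl _) (msuppZ_le _ _)).
rewrite mulr_sumr; apply: eq_bigr => k _.
rewrite mulr_sumr; apply: eq_bigr => l _.
by rewrite mcoeffZ mulrCA mulrnAr.
Qed.
HB.instance Definition _ :=
  GRing.Lalgebra_isAlgebra.Build K free_alg_type free_scaleAr.

Definition free_alg : algType K := free_alg_type.

Definition free_gen (i : I) : free_alg := (<< fmu i >> : {malg K[{fmonom I}]}).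

End FreeAlgebra.

Section Functional.
Variables (K : fieldType) (V : lmodType K).

Lemma exists_functional (v : V) : v != 0 ->
  exists phi : V -> K, [/\ forall x y, phi (x + y) = phi x + phi y,
    forall c x, phi (c *: x) = c * phi x & phi v = 1].
Proof.
move=> v0.
pose P (W : set V) := [/\ forall x y, W x -> W y -> W (x + y),
  forall c x, W x -> W (c *: x) & ~ W v].
have [W [[WD WZ Wv] Wmax]] : exists W, P W /\ (forall B, W `<` B -> ~ P B).
  apply: Zorn_bigcup => F FP Ftot; split.
  - move=> x y [X FX Xx] [Y FY Yy].
    have [XY|YX] := Ftot _ _ FX FY.
      by exists Y => //; case: (FP _ FY) => + _ _; apply => //; apply: XY.
    by exists X => //; case: (FP _ FX) => + _ _; apply => //; apply: YX.
  - by move=> c x [X FX Xx]; exists X => //; case: (FP _ FX) => _ + _; apply.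
  - by case=> X FX; case: (FP _ FX).
have W0 : W 0.
  apply: contrapT => W0; apply: (Wmax [set x | W x \/ x = 0]).
    by split=> [x Wx|/(_ 0) H]; [left | apply: W0; apply: H; right].
  split.
  - move=> x y [Wx|->] [Wy|->]; rewrite ?(add0r, addr0);
      by [left; apply: WD | left | right].
  - by move=> c x [Wx|->]; [left; apply: WZ | right; rewrite scaler0].
  - by case=> // /eqP; apply/negP.
have span a : exists c, W (a - c *: v).
  have [Wa|Wa] := pselect (W a); first by exists 0; rewrite scale0r subr0.
  apply: contrapT => noc.
  apply: (Wmax [set x | exists w c, W w /\ x = w + c *: a]).
    split=> [x Wx|/(_ a) H]; first by exists x, 0; rewrite scale0r addr0.
    by apply: Wa; apply: H; exists 0, 1; rewrite scale1r add0r.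
  split.
  - move=> _ _ [w [c [Ww ->]]] [w' [c' [Ww' ->]]]; exists (w + w'), (c + c').
    by rewrite scalerDl addrACA; split=> //; apply: WD.
  - move=> d _ [w [c [Ww ->]]]; exists (d *: w), (d * c).
    by rewrite scalerDr scalerA; split=> //; apply: WZ.
  - case=> w [c [Ww vE]]; apply: noc; have [c0|c0] := eqVneq c 0.
      by case: Wv; rewrite vE c0 scale0r addr0.
    exists c^-1; rewrite vE scalerDr scalerA mulVf // scale1r opprD addrCA.
    by rewrite subrr addr0 -scaleN1r scalerA; apply: WZ.
have uniq a c d : W (a - c *: v) -> W (a - d *: v) -> c = d.
  move=> Wc Wd; apply/eqP; rewrite -subr_eq0; apply/negP => /negP cd.
  apply: Wv; have : W ((c - d) *: v).
    have -> : (c - d) *: v = (a - d *: v) + -1 *: (a - c *: v).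
      by rewrite scaleN1r opprB [RHS]addrC [RHS]addrA subrK -scalerBl.
    by apply: WD => //; apply: WZ.
  by move/(WZ (c - d)^-1); rewrite scalerA mulVf // scale1r.
pose phi a := projT1 (cid (span a)).
have phiP a : W (a - phi a *: v) by rewrite /phi; case: cid.
exists phi; split=> [x y|c x|].
- apply: (uniq (x + y)) => //.
  by rewrite scalerDl opprD addrACA; apply: WD.
- by apply: (uniq (c *: x)) => //; rewrite -scalerA -scalerBr; apply: WZ.
- by apply: (uniq v) => //; rewrite scale1r subrr.
Qed.

End Functional.

Section Tensor.
Variables (K : fieldType) (A B : algType K).

(* A list of pairs (a_k, b_k) stands for \sum_k a_k (x) b_k; [teq] is the     *)
(* congruence generated by bilinearity.                                       *)
Inductive teq : seq (A * B) -> seq (A * B) -> Prop :=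
| teq_refl s : teq s s
| teq_sym s t : teq s t -> teq t s
| teq_trans t s u : teq s t -> teq t u -> teq s u
| teq_cat s s' t t' : teq s s' -> teq t t' -> teq (s ++ t) (s' ++ t')
| teq_catC s t : teq (s ++ t) (t ++ s)
| teq_0l b : teq [:: (0, b)] [::]
| teq_0r a : teq [:: (a, 0)] [::]
| teq_Dl a a' b : teq [:: (a + a', b)] [:: (a, b); (a', b)]
| teq_Dr a b b' : teq [:: (a, b + b')] [:: (a, b); (a, b')]
| teq_Z c a b : teq [:: (c *: a, b)] [:: (a, c *: b)].

Definition teqb s t : bool := `[< teq s t >].

Lemma teqb_equiv : equiv_class_of teqb.
Proof.
split=> [s|s t|t s u]; first by apply/asboolP/teq_refl.
  by apply/asboolP/asboolP; apply: teq_sym.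
by move=> /asboolP st /asboolP tu; apply/asboolP/(teq_trans st).
Qed.
Canonical teqb_equivRel := EquivRelPack teqb_equiv.

Definition tensor : Type := {eq_quot teqb}.
HB.instance Definition _ := Choice.on tensor.
HB.instance Definition _ := EqQuotient.on tensor.

Notation pi := (\pi_tensor).

Definition tens (a : A) (b : B) : tensor := pi [:: (a, b)].

Lemma tensor_eqP s t : pi s = pi t <-> teq s t.
Proof. by split=> [/eqmodP/asboolP //|st]; apply/eqmodP/asboolP. Qed.

Let tensor_pi_ind (P : tensor -> Prop) : (forall s, P (pi s)) -> forall x, P x.
Proof. by move=> Ppi x; rewrite -[x]reprK. Qed.

Let reprT s : teq (repr (pi s)) s.
Proof. by apply/tensor_eqP; rewrite reprK. Qed.

Definition topps (s : seq (A * B)) := [seq (- p.1, p.2) | p <- s].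
Definition tscales (c : K) (s : seq (A * B)) := [seq (c *: p.1, p.2) | p <- s].
Definition tmuls (s t : seq (A * B)) :=
  [seq (p.1 * q.1, p.2 * q.2) | p <- s, q <- t].

Definition tensor_opp (x : tensor) : tensor := pi (topps (repr x)).
Definition tensor_add (x y : tensor) : tensor := pi (repr x ++ repr y).
Definition tensor_mul (x y : tensor) : tensor := pi (tmuls (repr x) (repr y)).
Definition tensor_scale c (x : tensor) : tensor := pi (tscales c (repr x)).

Let catr s t t' : teq t t' -> teq (s ++ t) (s ++ t').
Proof. by apply: teq_cat; apply: teq_refl. Qed.
Let catl s s' t : teq s s' -> teq (s ++ t) (s' ++ t).
Proof. by move=> ss'; apply: teq_cat => //; apply: teq_refl. Qed.
Let teq_catACA s t u v : teq ((s ++ t) ++ (u ++ v)) ((s ++ u) ++ (t ++ v)).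
Proof.
rewrite -!catA; apply: catr; rewrite !catA; apply: catl; exact: teq_catC.
Qed.

Let teq_map2 (f : A * B -> A * B) :
    (forall b, teq [:: f (0, b)] [::]) -> (forall a, teq [:: f (a, 0)] [::]) ->
    (forall a a' b, teq [:: f (a + a', b)] [:: f (a, b); f (a', b)]) ->
    (forall a b b', teq [:: f (a, b + b')] [:: f (a, b); f (a, b')]) ->
    (forall c a b, teq [:: f (c *: a, b)] [:: f (a, c *: b)]) ->
  forall s t, teq s t -> teq (map f s) (map f t).
Proof.
move=> f0l f0r fDl fDr fZ s t; elim=> {s t} //=.
- by move=> s; apply: teq_refl.
- by move=> s t _; apply: teq_sym.
- by move=> t s u _ + _; apply: teq_trans.
- by move=> s s' t t' _ ss' _ tt'; rewrite !map_cat; apply: teq_cat.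
- by move=> s t; rewrite !map_cat; apply: teq_catC.
Qed.

Let topps_teq s t : teq s t -> teq (topps s) (topps t).
Proof.
apply: teq_map2 => [b|a|a a' b|a b b'|c a b] /=.
- by rewrite oppr0; apply: teq_0l.
- exact: teq_0r.
- by rewrite opprD; apply: teq_Dl.
- exact: teq_Dr.
- by rewrite -scalerN; apply: teq_Z.
Qed.

Let tscales_teq k s t : teq s t -> teq (tscales k s) (tscales k t).
Proof.
apply: teq_map2 => [b|a|a a' b|a b b'|c a b] /=.
- by rewrite scaler0; apply: teq_0l.
- exact: teq_0r.
- by rewrite scalerDr; apply: teq_Dl.
- exact: teq_Dr.
- by rewrite scalerA mulrC -scalerA; apply: teq_Z.
Qed.

Let tmuls_cons p s t :
  tmuls (p :: s) t = [seq (p.1 * q.1, p.2 * q.2) | q <- t] ++ tmuls s t.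
Proof. by []. Qed.

Let tmuls_cons_r s q t :
  teq (tmuls s (q :: t)) ([seq (p.1 * q.1, p.2 * q.2) | p <- s] ++ tmuls s t).
Proof.
elim: s => [|p s IHs]; first exact: teq_refl.
rewrite !tmuls_cons !map_cons.
apply: (teq_trans (catr _ IHs)).
exact: (teq_catACA [:: _] _ _ _).
Qed.

Let tmuls_nil s : tmuls s [::] = [::].
Proof. by elim: s. Qed.

Let tmuls_teql s s' t : teq s s' -> teq (tmuls s t) (tmuls s' t).
Proof.
move=> ss'; elim: t => [|q t IHt]; first by rewrite !tmuls_nil; apply: teq_refl.
apply: (teq_trans (tmuls_cons_r _ _ _)).
apply: teq_trans (teq_sym (tmuls_cons_r _ _ _)).
apply: teq_cat IHt; move: ss'.
apply: teq_map2 => [b|a|a a' b|a b b'|c a b] /=.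
- by rewrite mul0r; apply: teq_0l.
- by rewrite mul0r; apply: teq_0r.
- by rewrite mulrDl; apply: teq_Dl.
- by rewrite mulrDl; apply: teq_Dr.
- by rewrite -!scalerAl; apply: teq_Z.
Qed.

Let tmuls_teqr s t t' : teq t t' -> teq (tmuls s t) (tmuls s t').
Proof.
move=> tt'; elim: s => [|p s IHs]; first exact: teq_refl.
rewrite !tmuls_cons; apply: teq_cat IHs; move: tt'.
apply: teq_map2 => [b|a|a a' b|a b b'|c a b] /=.
- by rewrite mulr0; apply: teq_0l.
- by rewrite mulr0; apply: teq_0r.
- by rewrite mulrDr; apply: teq_Dl.
- by rewrite mulrDr; apply: teq_Dr.
- by rewrite -!scalerAr; apply: teq_Z.
Qed.

Let oppE s : tensor_opp (pi s) = pi (topps s).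
Proof. by apply/tensor_eqP/topps_teq/reprT. Qed.
Let addE s t : tensor_add (pi s) (pi t) = pi (s ++ t).
Proof. by apply/tensor_eqP/teq_cat; apply: reprT. Qed.
Let mulE s t : tensor_mul (pi s) (pi t) = pi (tmuls s t).
Proof.
apply/tensor_eqP; apply: (teq_trans (tmuls_teql _ (reprT _))).
exact: tmuls_teqr.
Qed.
Let scaleE c s : tensor_scale c (pi s) = pi (tscales c s).
Proof. by apply/tensor_eqP/tscales_teq/reprT. Qed.

Let tensor_addA : associative tensor_add.
Proof.
move=> x y z; elim/tensor_pi_ind: x => s; elim/tensor_pi_ind: y => t.
by elim/tensor_pi_ind: z => u; rewrite !addE catA.
Qed.
Let tensor_addC : commutative tensor_add.
Proof.
move=> x y; elim/tensor_pi_ind: x => s; elim/tensor_pi_ind: y => t.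
by rewrite !addE; apply/tensor_eqP/teq_catC.
Qed.
Let tensor_add0 : left_id (pi [::]) tensor_add.
Proof. by move=> x; elim/tensor_pi_ind: x => s; rewrite addE. Qed.
Let tensor_addN : left_inverse (pi [::]) tensor_opp tensor_add.
Proof.
move=> x; elim/tensor_pi_ind: x => s; rewrite oppE addE; apply/tensor_eqP.
elim: s => [|[a b] s IHs]; first exact: teq_refl.
apply: (teq_trans (teq_catACA [:: (- a, b)] _ [:: (a, b)] _)).
rewrite -[X in teq _ X]cat0s; apply: teq_cat IHs.
apply: (teq_trans (teq_sym (teq_Dl _ _ _))).
by rewrite addNr; apply: teq_0l.
Qed.
HB.instance Definition _ := GRing.isZmodule.Build tensor
  tensor_addA tensor_addC tensor_add0 tensor_addN.

Let piD s t : pi s + pi t = pi (s ++ t). Proof. exact: addE. Qed.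

Lemma tensor_sum (s : seq (A * B)) :
  \pi_tensor s = \sum_(p <- s) tens p.1 p.2.
Proof.
elim: s => [|[a b] s IHs]; first by rewrite big_nil.
by rewrite big_cons -IHs piD.
Qed.

Lemma tensor_ind (P : tensor -> Prop) :
    P 0 -> (forall a b x, P x -> P (tens a b + x)) -> forall x, P x.
Proof.
move=> P0 PD x; elim/tensor_pi_ind: x => s; rewrite tensor_sum.
by elim: s => [|p s IHs]; rewrite ?big_nil // big_cons; apply: PD.
Qed.

Lemma tensDl a a' b : tens (a + a') b = tens a b + tens a' b.
Proof. by rewrite piD; apply/tensor_eqP/teq_Dl. Qed.
Lemma tensDr a b b' : tens a (b + b') = tens a b + tens a b'.
Proof. by rewrite piD; apply/tensor_eqP/teq_Dr. Qed.

Let tensor_mulDl : left_distributive tensor_mul tensor_add.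
Proof.
move=> x y z; elim/tensor_pi_ind: x => s; elim/tensor_pi_ind: y => t.
elim/tensor_pi_ind: z => u; rewrite !(addE, mulE); congr (pi _).
exact: allpairs_cat.
Qed.
Let tensor_mulDr : right_distributive tensor_mul tensor_add.
Proof.
move=> x y z; elim/tensor_pi_ind: x => s; elim/tensor_pi_ind: y => t.
elim/tensor_pi_ind: z => u; rewrite !(addE, mulE); apply/tensor_eqP.
elim: s => [|p s IHs]; first exact: teq_refl.
rewrite !tmuls_cons map_cat; apply: (teq_trans (catr _ IHs)).
exact: teq_catACA.
Qed.

Let mul0 x : tensor_mul 0 x = 0.
Proof. by elim/tensor_pi_ind: x => s; exact: mulE. Qed.
Let mulr0' x : tensor_mul x 0 = 0.
Proof.
by elim/tensor_pi_ind: x => s; rewrite [LHS]mulE tmuls_nil.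
Qed.
Let mul_tens a b a' b' :
  tensor_mul (tens a b) (tens a' b') = tens (a * a') (b * b').
Proof. exact: mulE. Qed.

Let mulDl x y z : tensor_mul (x + y) z = tensor_mul x z + tensor_mul y z.
Proof. exact: tensor_mulDl. Qed.
Let mulDr x y z : tensor_mul z (x + y) = tensor_mul z x + tensor_mul z y.
Proof. exact: tensor_mulDr. Qed.

Let tensor_mulA : associative tensor_mul.
Proof.
move=> x y z; elim/tensor_ind: x => [|a b x IHx]; first by rewrite !mul0.
rewrite !mulDl IHx; congr (_ + _) => {IHx}.
elim/tensor_ind: y => [|a' b' y IHy]; first by rewrite !(mul0, mulr0').
rewrite !(mulDl, mulDr) IHy; congr (_ + _) => {IHy}.
elim/tensor_ind: z => [|a'' b'' z IHz]; first by rewrite !(mul0, mulr0').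
by rewrite !(mulDl, mulDr) IHz !mul_tens !mulrA.
Qed.
Let tensor_mul1 : left_id (tens 1 1) tensor_mul.
Proof.
move=> x; elim/tensor_ind: x => [|a b x IHx]; first exact: mulr0'.
by rewrite mulDr IHx mul_tens !mul1r.
Qed.
Let tensor_mulr1 : right_id (tens 1 1) tensor_mul.
Proof.
move=> x; elim/tensor_ind: x => [|a b x IHx]; first exact: mul0.
by rewrite mulDl IHx mul_tens !mulr1.
Qed.
Let tensor_10 : tens 1 1 != 0.
Proof.
apply/eqP => /tensor_eqP.
have [phi [phiD phiZ phi1]] := exists_functional (oner_neq0 A).
have phi0 : phi 0 = 0 by rewrite -[0](scale0r (1 : A)) phiZ mul0r.
pose ev (s : seq (A * B)) : B := \sum_(p <- s) phi p.1 *: p.2.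
have evE s t : teq s t -> ev s = ev t.
  elim=> {s t} //.
  - by move=> t s u _ -> _ ->.
  - by move=> s s' t t' _ + _; rewrite /ev !big_cat /= => -> ->.
  - by move=> s t; rewrite /ev !big_cat /= addrC.
  - by move=> b; rewrite /ev big_nil big_seq1 /= phi0 scale0r.
  - by move=> a; rewrite /ev big_nil big_seq1 /= scaler0.
  - by move=> a a' b; rewrite /ev !big_cons big_nil /= phiD scalerDl !addr0.
  - by move=> a b b'; rewrite /ev !big_cons big_nil /= scalerDr !addr0.
  - by move=> c a b; rewrite /ev !big_seq1 /= phiZ scalerA mulrC.
move/evE; rewrite /ev big_seq1 big_nil /= phi1 scale1r.
by apply/eqP/oner_neq0.
Qed.
HB.instance Definition _ := GRing.Zmodule_isNzRing.Build tensor
  tensor_mulA tensor_mul1 tensor_mulr1 tensor_mulDl tensor_mulDr tensor_10.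

Lemma tensM a b a' b' : tens a b * tens a' b' = tens (a * a') (b * b').
Proof. exact: mul_tens. Qed.
Lemma tens11 : 1 = tens 1 1. Proof. by []. Qed.

Let scale_tens c a b : tensor_scale c (tens a b) = tens (c *: a) b.
Proof. exact: scaleE. Qed.
Let tensor_scaleDr : right_distributive tensor_scale +%R.
Proof.
move=> c x y; elim/tensor_pi_ind: x => s; elim/tensor_pi_ind: y => t.
by rewrite piD !scaleE piD -map_cat.
Qed.
Let scale0' c : tensor_scale c 0 = 0. Proof. exact: scaleE. Qed.
Let tensor_scaleA a b x :
  tensor_scale a (tensor_scale b x) = tensor_scale (a * b) x.
Proof.
elim/tensor_ind: x => [|u v x IHx]; first by rewrite !scale0'.
by rewrite !tensor_scaleDr IHx !scale_tens scalerA.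
Qed.
Let tensor_scale1 : left_id 1 tensor_scale.
Proof.
move=> x; elim/tensor_ind: x => [|u v x IHx]; first by rewrite !scale0'.
by rewrite !tensor_scaleDr IHx !scale_tens scale1r.
Qed.
Let tensor_scaleDl x : {morph tensor_scale^~ x : a b / a + b}.
Proof.
move=> a b; elim/tensor_ind: x => [|u v x IHx]; first by rewrite !scale0' addr0.
by rewrite !tensor_scaleDr IHx !scale_tens scalerDl tensDl addrACA.
Qed.
HB.instance Definition _ := GRing.Zmodule_isLmodule.Build K tensor
  tensor_scaleA tensor_scale1 tensor_scaleDr tensor_scaleDl.

Lemma tensZl c a b : tens (c *: a) b = c *: tens a b.
Proof. by rewrite -scale_tens. Qed.
Lemma tensZr c a b : tens a (c *: b) = c *: tens a b.
Proof. by rewrite -tensZl; apply/esym/tensor_eqP/teq_Z. Qed.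

Let tensor_scaleAl c (x y : tensor) : c *: (x * y) = c *: x * y.
Proof.
elim/tensor_ind: x => [|a b x IHx]; first by rewrite !(mul0r, scaler0).
rewrite !(mulrDl, scalerDr) IHx; congr (_ + _) => {IHx}.
elim/tensor_ind: y => [|a' b' y IHy]; first by rewrite !(mulr0, scaler0).
by rewrite !(mulrDr, scalerDr) IHy tensM -!tensZl tensM scalerAl.
Qed.
Let tensor_scaleAr c (x y : tensor) : c *: (x * y) = x * (c *: y).
Proof.
elim/tensor_ind: x => [|a b x IHx]; first by rewrite !(mul0r, scaler0).
rewrite !(mulrDl, scalerDr) IHx; congr (_ + _) => {IHx}.
elim/tensor_ind: y => [|a' b' y IHy]; first by rewrite !(mulr0, scaler0).
by rewrite !(mulrDr, scalerDr) IHy tensM -!tensZl tensM scalerAr.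
Qed.
HB.instance Definition _ :=
  GRing.Lmodule_isLalgebra.Build K tensor tensor_scaleAl.
HB.instance Definition _ :=
  GRing.Lalgebra_isAlgebra.Build K tensor tensor_scaleAr.

End Tensor.

Section TensorMap.
Variables (K : fieldType) (A A' B B' : algType K).
Variables (f : {lrmorphism A -> A'}) (g : {lrmorphism B -> B'}).

Definition tensor_map (x : tensor A B) : tensor A' B' :=
  \sum_(p <- repr x) tens (f p.1) (g p.2).

Let tmapE (s : seq (A * B)) :
  tensor_map (\pi_(tensor A B) s) = \sum_(p <- s) tens (f p.1) (g p.2).
Proof.
have tmE (r t : seq (A * B)) : teq r t ->
    \sum_(p <- r) tens (f p.1) (g p.2) = \sum_(p <- t) tens (f p.1) (g p.2).
  elim=> {r t} //.
  - by move=> t r u _ -> _ ->.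
  - by move=> r r' t t' _ rr' _ tt'; rewrite !big_cat /= rr' tt'.
  - by move=> r t; rewrite !big_cat /= addrC.
  - move=> b; rewrite big_nil big_seq1 /= -[0](scale0r 0) linearZ.
    by rewrite tensZl scale0r.
  - move=> a; rewrite big_nil big_seq1 /= -[0](scale0r 0) linearZ.
    by rewrite tensZr scale0r.
  - by move=> a a' b; rewrite !big_cons big_nil /= rmorphD tensDl !addr0.
  - by move=> a b b'; rewrite !big_cons big_nil /= rmorphD tensDr !addr0.
  - by move=> c a b; rewrite !big_seq1 /= !linearZ tensZl tensZr.
by apply/tmE/tensor_eqP; rewrite reprK.
Qed.

Lemma tensor_map_tens a b : tensor_map (tens a b) = tens (f a) (g b).
Proof. by rewrite tmapE big_seq1. Qed.

Let tmapD x y : tensor_map (x + y) = tensor_map x + tensor_map y.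
Proof.
rewrite -[x]reprK -[y]reprK; set s := repr x; set t := repr y.
have <- : \pi_(tensor A B) (s ++ t) =
    (\pi_(tensor A B) s : tensor A B) + (\pi_(tensor A B) t : tensor A B).
  by rewrite !tensor_sum big_cat.
by rewrite !tmapE big_cat.
Qed.
Let tmap0 : tensor_map 0 = 0. Proof. by rewrite [LHS]tmapE big_nil. Qed.

Lemma tensor_map_linear : linear tensor_map.
Proof.
move=> c x y; rewrite tmapD; congr (_ + _).
elim/tensor_ind: x => [|a b x IHx]; first by rewrite scaler0 tmap0 scaler0.
rewrite scalerDr !tmapD IHx scalerDr -tensZl !tensor_map_tens.
by rewrite linearZ tensZl.
Qed.

Lemma tensor_map_monoid : monoid_morphism tensor_map.
Proof.
split=> [|x y]; first by rewrite tens11 tensor_map_tens !rmorph1.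
elim/tensor_ind: x => [|a b x IHx]; first by rewrite mul0r tmap0 mul0r.
rewrite !(mulrDl, tmapD) IHx; congr (_ + _) => {IHx}.
elim/tensor_ind: y => [|a' b' y IHy]; first by rewrite mulr0 tmap0 mulr0.
by rewrite !(mulrDr, tmapD) IHy tensM !tensor_map_tens tensM !rmorphM.
Qed.

HB.instance Definition _ := GRing.isLinear.Build K (tensor A B) (tensor A' B') _
  tensor_map tensor_map_linear.
HB.instance Definition _ := GRing.isMonoidMorphism.Build (tensor A B)
  (tensor A' B') tensor_map tensor_map_monoid.

End TensorMap.
Arguments tensor_map : simpl never.
Arguments tens : simpl never.


Section FixedSubalgebra.
Variables (K : fieldType) (A : algType K) (P : {lrmorphism A -> A} -> Prop).

Definition fixed : {pred A} :=
  fun x => `[< forall f : {lrmorphism A -> A}, P f -> f x = x >].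

Record fixed_alg := FixedAlg { fixed_val : A; _ : fixed_val \in fixed }.

Lemma fixed_closed : GRing.subsemialg_closed fixed.
Proof.
split.
- by apply/asboolP => f _; rewrite rmorph1.
- split=> [|x y /asboolP fx /asboolP fy]; apply/asboolP => f Pf.
    by rewrite raddf0.
  by rewrite raddfD /= fx ?fy.
- by move=> c x /asboolP fx; apply/asboolP => f Pf; rewrite linearZ /= fx.
- move=> x y /asboolP fx /asboolP fy; apply/asboolP => f Pf.
  by rewrite rmorphM /= fx ?fy.
Qed.

HB.instance Definition _ := [isSub for fixed_val].
HB.instance Definition _ := [Choice of fixed_alg by <:].
HB.instance Definition _ :=
  GRing.SubChoice_isSubAlgebra.Build K A fixed fixed_alg fixed_closed.

Definition fixed_subalg : algType K := fixed_alg.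

Lemma fixed_val_linear : linear (fixed_val : fixed_subalg -> A).
Proof. by move=> c x y; rewrite -[fixed_val]/(\val) linearP. Qed.
Lemma fixed_val_monoid : monoid_morphism (fixed_val : fixed_subalg -> A).
Proof. by split=> [|x y]; rewrite -[fixed_val]/(\val) ?rmorph1 ?rmorphM. Qed.
HB.instance Definition _ :=
  GRing.isLinear.Build K fixed_subalg A _ fixed_val fixed_val_linear.
HB.instance Definition _ :=
  GRing.isMonoidMorphism.Build fixed_subalg A fixed_val fixed_val_monoid.

Definition fixed_incl : {lrmorphism fixed_subalg -> A} := fixed_val.

End FixedSubalgebra.

(* A function [x : nat -> A] stands for the formal power series               *)
(* x(u) = \sum_(r >= 0) x r u^-r.                                             *)
Section Series.
Variables (K : numFieldType) (A : algType K).
Implicit Types (x y d D : nat -> A).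

Definition ser_mul x y : nat -> A := fun n => \sum_(k < n.+1) x k * y (n - k)%N.

Definition ser_scale (f : nat -> K) x : nat -> A :=
  fun n => \sum_(k < n.+1) f k *: x (n - k)%N.

(* x(u - 1), by (u - 1)^-r = \sum_(n >= r) 'C(n - 1, r - 1) u^-n for r > 0.   *)
Definition ser_shift x : nat -> A :=
  fun n => if n is m.+1 then \sum_(r < m.+1) x r.+1 *+ 'C(m, r) else x 0%N.

(* The series whose n-th coefficient is [step n p], where [p] agrees with it  *)
(* below n and vanishes from n on.                                            *)
Section Recursion.
Variable step : nat -> (nat -> A) -> A.

Fixpoint rec_prefix (n : nat) : seq A :=
  if n is m.+1 then rcons (rec_prefix m) (step m (nth 0 (rec_prefix m)))
  else [::].

Definition ser_rec : nat -> A := fun n => step n (nth 0 (rec_prefix n)).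

Lemma nth_rec_prefix n k :
  nth 0 (rec_prefix n) k = if (k < n)%N then ser_rec k else 0.
Proof.
have sz m : size (rec_prefix m) = m.
  by elim: m => //= m IHm; rewrite size_rcons IHm.
elim: n => [|n IHn]; first by rewrite nth_nil.
by rewrite nth_rcons sz IHn ltnS; case: ltngtP => // ->.
Qed.

End Recursion.

(* x(u)^-1 when x(u) has constant term 1                                      *)
Definition ser_inv x : nat -> A :=
  ser_rec (fun n p => (n == 0%N)%:R - ser_mul p x n).

(* The series d(u) with constant term 1 such that d(u) d(u - 1) = D(u), where *)
(* D(u) has constant term 1                                                   *)
Definition ser_shift_sqrt D : nat -> A :=
  ser_rec (fun n p =>
    if n == 0%N then 1 else 2%:R^-1 *: (D n - ser_mul p (ser_shift p) n)).

Lemma ser_mulVx x : x 0%N = 1 ->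
  forall n, ser_mul (ser_inv x) x n = (n == 0%N)%:R.
Proof.
move=> x0 n; rewrite /ser_mul big_ord_recr /= subnn x0 mulr1.
rewrite {2}/ser_inv /ser_rec -/(ser_inv x) [in X in _ + (_ - X)]/ser_mul.
rewrite big_ord_recr /= nth_rec_prefix ltnn mul0r addr0.
rewrite addrC -addrA [X in _ + X](_ : _ = 0) ?addr0 //.
rewrite addrC; apply/eqP; rewrite subr_eq0; apply/eqP/eq_bigr => k _.
by rewrite nth_rec_prefix ltn_ord.
Qed.

Lemma ser_shift_sqrt0 D : ser_shift_sqrt D 0%N = 1.
Proof. by []. Qed.

Lemma ser_shift_sqrtP D : D 0%N = 1 ->
  forall n, ser_mul (ser_shift_sqrt D) (ser_shift (ser_shift_sqrt D)) n = D n.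
Proof.
move=> D0 [|m]; first by rewrite /ser_mul big_ord1 /= !ser_shift_sqrt0 mulr1.
set d := ser_shift_sqrt D.
have split_top (y : nat -> A) : y 0%N = 1 ->
    ser_mul y (ser_shift y) m.+1 = y m.+1 *+ 2 +
      (\sum_(r < m) y r.+1 *+ 'C(m, r) +
       \sum_(k < m) y k.+1 * ser_shift y (m - k)%N).
  move=> y0; rewrite /ser_mul big_ord_recl big_ord_recr /= y0 mul1r subnn /= y0.
  by rewrite mulr1 big_ord_recr /= binn mulr1n mulr2n addrACA addrC.
pose p : nat -> A := nth 0 (rec_prefix (fun n p =>
    if n == 0%N then 1 else 2%:R^-1 *: (D n - ser_mul p (ser_shift p) n)) m.+1).
have pE k : p k = if (k < m.+1)%N then d k else 0 by exact: nth_rec_prefix.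
have dE : d m.+1 = 2%:R^-1 *: (D m.+1 - ser_mul p (ser_shift p) m.+1) by [].
have dE2 : d m.+1 *+ 2 = D m.+1 - ser_mul p (ser_shift p) m.+1.
  by rewrite dE -scaler_nat scalerA mulfV ?scale1r // Num.Theory.pnatr_eq0.
have p0 : p 0%N = 1 by rewrite pE.
rewrite (split_top d) // dE2 (split_top p) // (pE m.+1) ltnn mul0rn add0r.
rewrite -addrA [X in _ + X](_ : _ = 0) ?addr0 //.
apply/eqP; rewrite addrC subr_eq0; apply/eqP; congr (_ + _).
  by apply: eq_bigr => r _; rewrite pE ltnS ltn_ord.
apply: eq_bigr => k _; rewrite pE ltnS ltn_ord; congr (_ * _).
case: (m - k)%N (leq_subr k m) => [|q] qm //=.
apply: eq_bigr => r _; rewrite pE ltnS.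
by rewrite (leq_trans (ltn_ord r) qm).
Qed.

(* The coefficient of u^a in x(u)                                             *)
Definition ucoef x (a : int) : A := if a <= 0 then x `|a|%N else 0.

(* (u - v - c) F(u, v), where [F a b] is the coefficient of u^a v^b in        *)
(* F(u, v); likewise in [uvcomm] and [uvexch]                                 *)
Definition uvmul (c : K) (F : int -> int -> A) : int -> int -> A :=
  fun a b => F (a - 1) b - F a (b - 1) - c *: F a b.

(* x(u) y(v) - y(v) x(u)                                                      *)
Definition uvcomm x y : int -> int -> A :=
  fun a b => ucoef x a * ucoef y b - ucoef y b * ucoef x a.

(* x(u) y(v) - x(v) y(u)                                                      *)
Definition uvexch x y : int -> int -> A :=
  fun a b => ucoef x a * ucoef y b - ucoef x b * ucoef y a.

(* delta_ij + \sum_(r >= 1) x (i, j, r - 1) u^-r: the generator t_ij^(r) is   *)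
(* indexed by (i, j, r - 1).                                                  *)
Definition gen_ser (I : finType) (x : I * I * nat -> A) (i j : I) : nat -> A :=
  fun r => if r is m.+1 then x (i, j, m) else (i == j)%:R.

(* T_11(u) T_22(u - 1) - T_21(u) T_12(u - 1), the indices 1 and 2 of gl_2     *)
(* being [ord0] and [ord_max]                                                 *)
Definition ser_qdet (T : 'I_2 -> 'I_2 -> nat -> A) : nat -> A := fun n =>
  ser_mul (T ord0 ord0) (ser_shift (T ord_max ord_max)) n
  - ser_mul (T ord_max ord0) (ser_shift (T ord0 ord_max)) n.

Lemma ser_qdet0 (x : 'I_2 * 'I_2 * nat -> A) : ser_qdet (gen_ser x) 0%N = 1.
Proof. by rewrite /ser_qdet /ser_mul !big_ord1 /= mulr1 mulr0 subr0. Qed.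

(* The coefficient of u^a v^b in LHS - RHS of the relation of Y(gl_2)         *)
Definition gl2_relator (T : 'I_2 -> 'I_2 -> nat -> A) (i j k l : 'I_2)
    (a b : int) : A :=
  uvmul 0 (uvcomm (T i j) (T k l)) a b - uvexch (T k j) (T i l) a b.

End Series.

(* -2, -1, 1, 2 *)
Inductive o4idx := m2 | m1 | p1 | p2.

Definition o4neg (a : o4idx) : o4idx :=
  match a with m2 => p2 | m1 => p1 | p1 => m1 | p2 => m2 end.

Definition o4pair (a : o4idx) : 'I_2 * 'I_2 :=
  match a with
  | m2 => (ord0, ord0) | m1 => (ord0, ord_max)
  | p1 => (ord_max, ord0) | p2 => (ord_max, ord_max)
  end.

Definition o4unpair (p : 'I_2 * 'I_2) : o4idx :=
  if p.1 == ord0 then (if p.2 == ord0 then m2 else m1)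
  else (if p.2 == ord0 then p1 else p2).

Lemma o4pairK : cancel o4pair o4unpair. Proof. by case. Qed.

HB.instance Definition _ := Finite.copy o4idx (can_type o4pairK).

Section O4Relator.
Variables (K : numFieldType) (A : algType K).

(* The coefficient of u^a v^b in LHS - RHS of the relation of X(o_4)          *)
(* multiplied by (u - v) (u - v - kappa), with kappa = 1                      *)
Definition o4_relator (t : o4idx -> o4idx -> nat -> A) (i j k l : o4idx)
    (a b : int) : A :=
  uvmul 0 (uvmul 1 (uvcomm (t i j) (t k l))) a b
  - (uvmul 1 (uvexch (t k j) (t i l)) a b
     - uvmul 0 (fun a b =>
         (k == o4neg i)%:R *
           (\sum_p ucoef (t p j) a * ucoef (t (o4neg p) l) b)
         - (l == o4neg j)%:R *
           (\sum_p ucoef (t k (o4neg p)) b * ucoef (t i p) a)) a b).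

End O4Relator.

Section Augmentation.
Variables (K : numFieldType) (I : choiceType).

Definition free_aug (x : free_alg K I) : K :=
  mcoeff (mone : {fmonom I}) (x : {malg K[{fmonom I}]}).

Lemma free_augB x y : free_aug (x - y) = free_aug x - free_aug y.
Proof. exact: raddfB. Qed.
Lemma free_aug0 : free_aug 0 = 0.
Proof. exact: raddf0. Qed.
Lemma free_augD x y : free_aug (x + y) = free_aug x + free_aug y.
Proof. exact: raddfD. Qed.
Lemma free_augM x y : free_aug (x * y) = free_aug x * free_aug y.
Proof. exact: (rmorphM (mcoeff (mone : {fmonom I}))). Qed.
Lemma free_aug1 : free_aug 1 = 1.
Proof. exact: (rmorph1 (mcoeff (mone : {fmonom I}))). Qed.
Lemma free_augZ c x : free_aug (c *: x) = c * free_aug x.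
Proof. exact: mcoeffZ. Qed.
Lemma free_aug_gen i : free_aug (free_gen K i) = 0.
Proof.
rewrite /free_aug mcoeffU1; case: eqP => // /(congr1 (@fmonom_val I)).
by rewrite fmU fm1.
Qed.

Lemma augmented_proper (S : set (free_alg K I)) :
  (forall x, S x -> free_aug x = 0) -> ~ ideal_gen S 1.
Proof.
move=> S0 /(_ [set x | free_aug x = 0]) aug1.
have /eqP : free_aug 1 = 0; last by rewrite free_aug1 oner_eq0.
apply: aug1; split=> [|x /S0 //]; split=> [|x y x0 y0|a x b x0] /=.
- exact: free_aug0.
- by rewrite free_augD x0 y0 addr0.
- by rewrite !free_augM x0 mulr0 mul0r.
Qed.

End Augmentation.

Section AugmentedRelators.
Variables (K : numFieldType) (A : algType K) (e : A -> K).
Hypothesis eB : forall x y, e (x - y) = e x - e y.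
Hypothesis eD : forall x y, e (x + y) = e x + e y.
Hypothesis eM : forall x y, e (x * y) = e x * e y.
Hypothesis eZ : forall c x, e (c *: x) = c * e x.
Hypothesis e1 : e 1 = 1.

Let e0 : e 0 = 0. Proof. by rewrite -[0 in LHS](subrr 0) eB subrr. Qed.
Let e_nat (b : bool) : e b%:R = b%:R. Proof. by case: b. Qed.
Let e_sum (J : finType) (G : J -> A) : e (\sum_p G p) = \sum_p e (G p).
Proof. exact: (big_morph e eD e0). Qed.

Section Family.
Variables (I : finType) (x : I * I * nat -> A).
Hypothesis ex : forall q, e (x q) = 0.
Let gen := gen_ser x.

Let e_gen i j (a : int) : e (ucoef (gen i j) a) = (a == 0)%:R * (i == j)%:R.
Proof.
rewrite /ucoef; case: (a =P 0) => [->|/eqP a0].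
  by rewrite lexx mul1r e_nat.
rewrite mul0r; case: ifP => _; last exact: e0.
by move: a0; rewrite -absz_eq0; case: absz => //= m _; apply: ex.
Qed.

Lemma e_uvcomm i j k l a b : e (uvcomm (gen i j) (gen k l) a b) = 0.
Proof. by rewrite /uvcomm eB !eM mulrC subrr. Qed.

Lemma e_uvexch i j k l a b : e (uvexch (gen i j) (gen k l) a b) = 0.
Proof.
rewrite /uvexch eB !eM !e_gen; apply/eqP; rewrite subr_eq0; apply/eqP.
by rewrite mulrACA [RHS]mulrACA [(b == 0)%:R * _]mulrC.
Qed.

Lemma e_sum_uv (s : I -> I) (sK : involutive s) j l a b :
  e (\sum_p ucoef (gen p j) a * ucoef (gen (s p) l) b) =
  (a == 0)%:R * (b == 0)%:R * (l == s j)%:R.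
Proof.
rewrite e_sum (bigD1 j) //= big1 => [|p /negPf pj].
  by rewrite eM !e_gen eqxx mulr1 addr0 mulrA [s j == l]eq_sym.
by rewrite eM !e_gen pj mulr0 mul0r.
Qed.

Lemma e_sum_vu (s : I -> I) (sK : involutive s) i k a b :
  e (\sum_p ucoef (gen k (s p)) b * ucoef (gen i p) a) =
  (a == 0)%:R * (b == 0)%:R * (k == s i)%:R.
Proof.
rewrite e_sum (bigD1 i) //= big1 => [|p /negPf pj].
  by rewrite eM !e_gen eqxx mulr1 addr0 mulrC mulrA.
by rewrite eM !e_gen [i == p]eq_sym pj !mulr0.
Qed.

End Family.

Lemma e_uvmul c (G : int -> int -> A) a b : (forall a b, e (G a b) = 0) ->
  e (uvmul c G a b) = 0.
Proof. by move=> G0; rewrite /uvmul !eB eZ !G0 mulr0 !subr0. Qed.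

Lemma e_gl2_relator x i j k l a b : (forall q, e (x q) = 0) ->
  e (gl2_relator (gen_ser x) i j k l a b) = 0.
Proof.
move=> ex; rewrite /gl2_relator eB e_uvexch // subr0.
by apply: e_uvmul => {}a {}b; apply: e_uvcomm.
Qed.

Lemma e_o4_relator x i j k l a b : (forall q, e (x q) = 0) ->
  e (o4_relator (gen_ser x) i j k l a b) = 0.
Proof.
move=> ex; have negK : involutive o4neg by case.
have eB0 x1 x2 : e x1 = 0 -> e x2 = 0 -> e (x1 - x2) = 0.
  by move=> x10 x20; rewrite eB x10 x20 subrr.
rewrite /o4_relator; apply: (eB0 _ _); last apply: (eB0 _ _).
- by apply: e_uvmul => {}a {}b; apply: e_uvmul => {}a {}b; apply: e_uvcomm.
- by apply: e_uvmul => {}a {}b; apply: e_uvexch.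
- apply: e_uvmul => {}a {}b.
  rewrite eB eM [in X in _ - X]eM e_sum_uv // e_sum_vu // !e_nat.
  by rewrite mulrCA [X in _ - X]mulrCA [X in _ - _ * X]mulrC subrr.
Qed.

End AugmentedRelators.

Section Yangians.
Variable K : numFieldType.

Definition gl2_free := free_alg K ('I_2 * 'I_2 * nat)%type.
Definition o4_free := free_alg K (o4idx * o4idx * nat)%type.

Definition gl2_relset : set gl2_free := [set x | exists i j k l a b,
  x = gl2_relator (gen_ser (@free_gen K _)) i j k l a b].

Definition o4_relset : set o4_free := [set x | exists i j k l a b,
  x = o4_relator (gen_ser (@free_gen K _)) i j k l a b].

Lemma gl2_relset_proper : ~ ideal_gen gl2_relset 1.
Proof.
apply: augmented_proper => _ [i [j [k [l [a [b ->]]]]]].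
by apply: e_gl2_relator; [apply: free_augB | apply: free_augM | apply: free_augZ
  | apply: free_aug1 | apply: free_aug_gen].
Qed.

Lemma o4_relset_proper : ~ ideal_gen o4_relset 1.
Proof.
apply: augmented_proper => _ [i [j [k [l [a [b ->]]]]]].
by apply: e_o4_relator; [apply: free_augB | apply: free_augD
  | apply: free_augM | apply: free_augZ | apply: free_aug1
  | apply: free_aug_gen].
Qed.

Definition gl2_relators : relators gl2_free := Relators gl2_relset_proper.
Definition o4_relators : relators o4_free := Relators o4_relset_proper.

Definition Ygl2 : algType K := alg_quot gl2_relators.
Definition Xo4 : algType K := alg_quot o4_relators.

Definition Tser : 'I_2 -> 'I_2 -> nat -> Ygl2 :=
  gen_ser (fun q => quot_proj gl2_relators (free_gen K q)).
Definition tser : o4idx -> o4idx -> nat -> Xo4 :=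
  gen_ser (fun q => quot_proj o4_relators (free_gen K q)).

(* t_ij(u) |-> f(u) t_ij(u) for some f(u) in 1 + u^-1 K[[u^-1]]               *)
Definition scaling_automorphism (A : algType K) (I : Type)
    (t : I -> I -> nat -> A) (alpha : {lrmorphism A -> A}) : Prop :=
  bijective alpha /\
  exists f : nat -> K, f 0%N = 1 /\
    forall i j r, alpha (t i j r) = ser_scale f (t i j) r.

Definition Ysl2 : algType K := fixed_subalg (scaling_automorphism Tser).
Definition Yo4 : algType K := fixed_subalg (scaling_automorphism tser).

Definition Ysl2_incl : {lrmorphism Ysl2 -> Ygl2} :=
  fixed_incl (scaling_automorphism Tser).
Definition Yo4_incl : {lrmorphism Yo4 -> Xo4} :=
  fixed_incl (scaling_automorphism tser).

Definition qdet : nat -> Ygl2 := ser_qdet Tser.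

Definition qdet_d : nat -> Ygl2 := ser_shift_sqrt qdet.

Lemma qdet0 : qdet 0%N = 1.
Proof. exact: ser_qdet0. Qed.

Lemma qdet_dP n : ser_mul qdet_d (ser_shift qdet_d) n = qdet n.
Proof. exact: ser_shift_sqrtP qdet0 n. Qed.

Definition calT (i j : 'I_2) : nat -> Ygl2 :=
  ser_mul (ser_inv qdet_d) (Tser i j).

Definition is_projection (pr : {lrmorphism Ygl2 -> Ysl2}) : Prop :=
  forall i j r, Ysl2_incl (pr (Tser i j r)) = calT i j r.

Definition o4eps (a : o4idx) : K := if a is p2 then -1 else 1.

Definition is_psi (psi : {lrmorphism Xo4 -> tensor Ygl2 Ygl2}) : Prop :=
  forall a b r, psi (tser a b r) =
    (o4eps a * o4eps b) *:
      ser_mul (fun n => tens (Tser (o4pair a).1 (o4pair b).1 n) 1)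
              (fun n => tens 1 (Tser (o4pair a).2 (o4pair b).2 n)) r.

End Yangians.

(* Main.v *)
(* Write id for the identity of the first tensor factor. If beta is the
   automorphism T(u) |-> f(u) T(u) of Y(gl_2), then (id (x) beta) o chi1 agrees
   with chi1 o alpha on the generators, where alpha is t(u) |-> f(u) t(u); so
   chi1 intertwines the two families of automorphisms, and it maps Y(o_4) onto
   the elements of Y(sl_2) (x) Y(gl_2) fixed by all id (x) beta. Over a field,
   these form Y(sl_2) (x) Y(sl_2). The case of chi2 follows by exchanging the
   tensor factors. *)
Require Import Defs.
From mathcomp Require Import all_boot all_order all_algebra complex reals.
From HB Require Import structures.
From mathcomp Require Import zify.
From mathcomp Require Import generic_quotient boolp classical_sets.
From mathcomp Require Import finmap monalg.

Set Implicit Arguments.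
Unset Strict Implicit.
Unset Printing Implicit Defensive.

Import Order.TTheory GRing.Theory Num.Theory.
Local Open Scope ring_scope.

(** * Factoring and inverting algebra morphisms *)

Section LrmorphismFactor.
Variables (K : fieldType) (X P Q : algType K).

Lemma exists_lrmorphism (f : X -> P) : linear f -> monoid_morphism f ->
  exists g : {lrmorphism X -> P}, f =1 g.
Proof.
move=> lin_f mon_f.
pose gL := GRing.isLinear.Build K X P *:%R f lin_f.
pose gM := GRing.isMonoidMorphism.Build X P f mon_f.
pose g : {lrmorphism X -> P} := HB.pack f gL gM.
by exists g.
Qed.

(** Preimages under the injective [i] are unique, so choosing them respects the operations. This
    serves to corestrict a morphism to a subalgebra. *)
Lemma lrmorphism_factor (i : {lrmorphism P -> Q}) (h : {lrmorphism X -> Q}) :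
    injective i -> (forall x, exists p, i p = h x) ->
  exists g : {lrmorphism X -> P}, forall x, i (g x) = h x.
Proof.
move=> i_inj i_im; pose f x := projT1 (cid (i_im x)).
have fP x : i (f x) = h x by rewrite /f; case: cid.
have [||g fg] := @exists_lrmorphism f.
- by move=> c x y; apply: i_inj; rewrite linearP /= !fP linearP.
- split=> [|x y]; apply: i_inj; first by rewrite fP !rmorph1.
  by rewrite rmorphM /= !fP rmorphM.
by exists g => x; rewrite -fg.
Qed.

End LrmorphismFactor.

(** Bijectivity provides only a bare function as inverse; factoring the identity through [f] yields
    a morphism. *)
Lemma lrmorphism_inverse (K : fieldType) (A B : algType K)
    (f : {lrmorphism A -> B}) : bijective f ->
  exists2 g : {lrmorphism B -> A}, cancel f g & cancel g f.
Proof.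
case=> f' f'K ff'.
have [|g gE] := @lrmorphism_factor _ _ _ _ f idfun (can_inj f'K).
  by move=> x; exists (f' x); apply: ff'.
exists g => x; last exact: gE.
by apply: (can_inj f'K); apply: gE.
Qed.

(** * Universal property, contractions and fixed elements of tensor products *)

Section TensorLift.
Variables (K : fieldType) (A B : algType K) (V : lmodType K).

Lemma tensor_lift (h : A -> B -> V) :
    (forall a a' b, h (a + a') b = h a b + h a' b) ->
    (forall a b b', h a (b + b') = h a b + h a b') ->
    (forall c a b, h (c *: a) b = c *: h a b) ->
    (forall c a b, h a (c *: b) = c *: h a b) ->
  exists g : {linear tensor A B -> V}, forall a b, g (tens a b) = h a b.
Proof.
move=> hDl hDr hZl hZr.
pose ev (s : seq (A * B)) : V := \sum_(p <- s) h p.1 p.2.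
have evE s t : teq s t -> ev s = ev t.
  elim=> {s t} //.
  - by move=> t s u _ -> _ ->.
  - by move=> s s' t t' _ + _; rewrite /ev !big_cat /= => -> ->.
  - by move=> s t; rewrite /ev !big_cat /= addrC.
  (* The zero clauses of [teq] follow from homogeneity, writing 0 as 0 times 0. *)
  - by move=> b; rewrite /ev big_nil big_seq1 /= -(scale0r 0) hZl scale0r.
  - by move=> a; rewrite /ev big_nil big_seq1 /= -(scale0r 0) hZr scale0r.
  - by move=> a a' b; rewrite /ev !big_cons big_nil /= hDl !addr0.
  - by move=> a b b'; rewrite /ev !big_cons big_nil /= hDr !addr0.
  - by move=> c a b; rewrite /ev !big_seq1 /= hZl hZr.
pose g (x : tensor A B) := ev (repr x).
have gpi s : g (\pi_(tensor A B) s)%qT = ev s.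
  by apply: evE; apply/tensor_eqP; rewrite reprK.
have gT a b : g (tens a b) = h a b by rewrite gpi /ev big_seq1.
have gD x y : g (x + y) = g x + g y.
  rewrite -[x]reprK -[y]reprK; set s := repr x; set t := repr y.
  have <- : (\pi_(tensor A B) (s ++ t) =
      (\pi_(tensor A B) s : tensor A B) + (\pi_(tensor A B) t : tensor A B))%qT.
    by rewrite !tensor_sum big_cat.
  by rewrite !gpi /ev big_cat.
have g0 : g 0 = 0 by apply: (addrI (g 0)); rewrite -gD !addr0.
have g_lin : linear g.
  move=> c x y; rewrite gD; congr (_ + _).
  elim/tensor_ind: x => [|a b x IHx]; first by rewrite scaler0 g0 scaler0.
  by rewrite scalerDr !gD IHx scalerDr -tensZl !gT hZl.
pose gL := GRing.isLinear.Build K (tensor A B) V *:%R g g_lin.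
by exists (HB.pack g gL : {linear tensor A B -> V}) => a b; apply: gT.
Qed.

End TensorLift.

Section TensorFactors.
Variables (K : fieldType) (A B : algType K).

Lemma tensor_rep (z : tensor A B) :
  exists s : seq (A * B), z = \sum_(p <- s) tens p.1 p.2.
Proof. by exists (repr z); rewrite -tensor_sum reprK. Qed.

Lemma tens0l (b : B) : tens (0 : A) b = 0.
Proof. by rewrite -[X in tens X](scale0r 0) tensZl scale0r. Qed.

Lemma tens0r (a : A) : tens a (0 : B) = 0.
Proof. by rewrite -[X in tens _ X](scale0r 0) tensZr scale0r. Qed.

Lemma tens_sumr (I : Type) (s : seq I) (a : A) (F : I -> B) :
  tens a (\sum_(i <- s) F i) = \sum_(i <- s) tens a (F i).
Proof.
by elim/big_rec2: _ => [|i x y _ <-]; rewrite ?tens0r ?tensDr.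
Qed.

(** This is [phi] tensored with the identity, followed by the identification of K (x) B with B. *)
Lemma tensor_contraction (phi : A -> K) :
    (forall x y, phi (x + y) = phi x + phi y) ->
    (forall c x, phi (c *: x) = c * phi x) ->
  exists g : {linear tensor A B -> B}, forall a b, g (tens a b) = phi a *: b.
Proof.
move=> phiD phiZ; apply: tensor_lift => [a a' b|a b b'|c a b|c a b].
- by rewrite phiD scalerDl.
- by rewrite scalerDr.
- by rewrite phiZ scalerA.
- by rewrite !scalerA mulrC.
Qed.

(* Gaussian elimination: if a is the first left factor of a sum z of pure
   tensors and phi a = 1, then z - a (x) (phi (x) id)(z) is a sum of pure
   tensors with one term fewer. *)
Lemma tensor_elim (W : tensor A B -> Prop) (V : B -> Prop) :
    (forall z a b, W z -> V b -> W (z - tens a b)) ->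
    (forall z (g : {linear tensor A B -> B}) (phi : A -> K),
       (forall x y, phi (x + y) = phi x + phi y) ->
       (forall c x, phi (c *: x) = c * phi x) ->
       (forall a b, g (tens a b) = phi a *: b) -> W z -> V (g z)) ->
  forall z, W z -> exists2 s : seq (A * B), z = \sum_(p <- s) tens p.1 p.2 &
    forall p, p \in s -> V p.2.
Proof.
move=> WV gV z; have [s ->] := tensor_rep z.
elim: {s}(size s) {-2}s (leqnn (size s)) => [|n IHn] [|[a b] s] //=.
- by exists [::].
- by exists [::].
rewrite ltnS big_cons /= => sn Wz; have [a0|a0] := eqVneq a 0.
  by move: Wz; rewrite a0 tens0l add0r; apply: IHn.
have [phi [phiD phiZ phi1]] := exists_functional a0.
have [g gE] := tensor_contraction phiD phiZ.
set z0 := _ + _ in Wz *.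
have Vw := gV _ _ _ phiD phiZ gE Wz; set w := g z0 in Vw.
have wE : w = b + \sum_(p <- s) phi p.1 *: p.2.
  rewrite /w linearD linear_sum /= gE phi1 scale1r; congr (_ + _).
  by apply: eq_bigr => p _; rewrite gE.
pose s' := [seq (p.1 - phi p.1 *: a, p.2) | p <- s].
have z0E : z0 - tens a w = \sum_(p <- s') tens p.1 p.2.
  rewrite big_map wE tensDr tens_sumr /z0 [tens a b + _]addrC addrKA -sumrB.
  apply: eq_bigr => p _.
  by rewrite /= tensDl -scaleNr tensZl scaleNr tensZr.
have [||t tE tV] := IHn s'; rewrite ?size_map //.
  by rewrite -z0E; apply: WV.
exists ((a, w) :: t); first by rewrite big_cons /= -tE -z0E addrC subrK.
by move=> p; rewrite inE => /orP[/eqP->|/tV].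
Qed.

End TensorFactors.

Section TensorIdmap.
Variables (K : fieldType) (A B B' : algType K).

Lemma contraction_natural (f : {lrmorphism B -> B'}) (phi : A -> K)
    (g : {linear tensor A B -> B}) (g' : {linear tensor A B' -> B'}) :
    (forall a b, g (tens a b) = phi a *: b) ->
    (forall a b, g' (tens a b) = phi a *: b) ->
  forall z, f (g z) = g' (tensor_map idfun f z).
Proof.
move=> gE g'E; elim/tensor_ind => [|a b z IHz]; first by rewrite !linear0.
by rewrite !linearD /= tensor_map_tens gE g'E linearZ IHz.
Qed.

(** Flatness over a field: elimination with the kernel as [W] and {0} as [V]. By naturality, the
    contraction of an element of the kernel is killed by the injective [f]. *)
Lemma tensor_idmap_inj (f : {lrmorphism B -> B'}) :
  injective f -> injective (tensor_map (idfun : {lrmorphism A -> A}) f).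
Proof.
move=> f_inj; apply: raddf_inj => z z0.
have [z' a b Wz -> | y g phi phiD phiZ gE Wy|s -> sV] := @tensor_elim K A B
    (fun z => tensor_map (idfun : {lrmorphism A -> A}) f z = 0)
    (fun b => b = 0) _ _ z z0.
- by rewrite tens0r subr0.
- have [g' g'E] := tensor_contraction B' phiD phiZ.
  by apply: f_inj; rewrite (contraction_natural f gE g'E) Wy !linear0.
- by rewrite big_seq big1 // => p /sV->; rewrite tens0r.
Qed.

End TensorIdmap.

Lemma tensor_idmap_bij (K : fieldType) (A B B' : algType K)
    (f : {lrmorphism B -> B'}) : bijective f ->
  bijective (tensor_map (idfun : {lrmorphism A -> A}) f).
Proof.
move=> /lrmorphism_inverse[g fK gK].
exists (tensor_map idfun g); elim/tensor_ind => [|a b z IHz];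
  by rewrite ?linear0 // !linearD /= IHz !tensor_map_tens /= ?fK ?gK.
Qed.

(** Elimination with the fixed tensors as [W] and the fixed elements of [B] as [V]: contraction
    commutes with each [f], so all right factors can be taken fixed. *)
Lemma tensor_fixed (K : fieldType) (A B : algType K)
    (P : {lrmorphism B -> B} -> Prop) (z : tensor A B) :
    (forall f, P f -> tensor_map idfun f z = z) ->
  exists y, tensor_map idfun (fixed_incl P) y = z.
Proof.
move=> z_fix.
have [z' a b Wz /asboolP bV f Pf | y g phi _ _ gE Wy|s -> sV] :=
    @tensor_elim K A B
      (fun z => forall f, P f -> tensor_map idfun f z = z)
      (fun b => b \in fixed P) _ _ z z_fix.
- by rewrite linearB /= tensor_map_tens Wz // bV.
- by apply/asboolP=> f Pf; rewrite (contraction_natural f gE gE) Wy.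
elim: s sV => [|[a b] s IHs] sV.
  by exists 0; rewrite big_nil linear0.
have [p ps|y yE] := IHs; first by apply: sV; rewrite inE ps orbT.
exists (tens a (FixedAlg (sV _ (mem_head _ _))) + y).
by rewrite linearD /= tensor_map_tens yE big_cons.
Qed.

Section TensorSwap.
Variables (K : fieldType) (A B : algType K).

Lemma exists_tensor_swap : exists s : {lrmorphism tensor A B -> tensor B A},
  forall a b, s (tens a b) = tens b a.
Proof.
have [||||g gE] := @tensor_lift K A B (tensor B A) (fun a b => tens b a).
- by move=> a a' b; rewrite tensDr.
- by move=> a b b'; rewrite tensDl.
- by move=> c a b; rewrite tensZr.
- by move=> c a b; rewrite tensZl.
have [||s sg] := @exists_lrmorphism _ _ _ g; last first.
- by exists s => a b; rewrite -sg gE.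
- split=> [|x y]; first by rewrite tens11 gE.
  elim/tensor_ind: x => [|a b x IHx]; first by rewrite mul0r !linear0 mul0r.
  rewrite mulrDl !linearD /= mulrDl IHx; congr (_ + _) => {IHx}.
  elim/tensor_ind: y => [|a' b' y IHy]; first by rewrite mulr0 !linear0 mulr0.
  by rewrite mulrDr !linearD /= mulrDr IHy tensM !gE tensM.
- exact: linearP.
Qed.

End TensorSwap.

(** * Universal properties of free algebras and of quotients by relators *)

Section FreeAlgebraUniversal.
Variables (K : fieldType) (I : choiceType).
Local Notation F := (free_alg K I).

Let monomial (m : {fmonom I}) : F := (<< m >> : {malg K[{fmonom I}]}).

Let monomial1 : monomial (FMonom [::]) = 1.
Proof. by rewrite -fmoneE. Qed.

Let monomial_cons i s :
  monomial (FMonom (i :: s)) = free_gen K i * monomial (FMonom s).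
Proof.
transitivity (monomial (mmul (fmu i) (FMonom s))).
  by congr monomial; apply/eqP; rewrite fmP fmM fmU.
rewrite -[LHS]/(<< _ >> : {malg K[{fmonom I}]}).
by rewrite -[1 in LHS](mulr1 1) -fgmulUU.
Qed.

Let free_alg_sum (x : F) : x =
  \sum_(m <- msupp (x : {malg K[{fmonom I}]})) mcoeff m x *: monomial m.
Proof.
rewrite {1}[x](@monalgE {fmonom I} K); apply: eq_bigr => m _.
by apply/malgP => k; rewrite mcoeffZ !mcoeffU mulr_natr.
Qed.

Lemma free_alg_ext (A : algType K) (f g : {lrmorphism F -> A}) :
  (forall i, f (free_gen K i) = g (free_gen K i)) -> f =1 g.
Proof.
move=> fg x; rewrite [x]free_alg_sum !linear_sum; apply: eq_bigr => m _.
rewrite !linearZ /=; congr (_ *: _); rewrite -[m]fmK.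
elim: (m : seq I) => [|i s IHs]; first by rewrite monomial1 !rmorph1.
by rewrite monomial_cons !rmorphM /= IHs fg.
Qed.

Lemma free_alg_lift (A : algType K) (v : I -> A) :
  exists f : {lrmorphism F -> A}, forall i, f (free_gen K i) = v i.
Proof.
pose h (m : {fmonom I}) : A := \prod_(i <- (m : seq I)) v i.
have h_mor : mmorphism h.
  split=> [m1 m2|]; first by rewrite /h fmM big_cat.
  by rewrite /h fm1 big_nil.
pose hM := isMultiplicative.Build {fmonom I} A h h_mor.
pose h' : {mmorphism {fmonom I} -> A} := HB.pack h hM.
pose e (x : F) : A := mmap (in_alg A) h' (x : {malg K[{fmonom I}]}).
have [||f fe] := @exists_lrmorphism _ _ _ e; last first.
- exists f => i; rewrite -fe /e mmapU /= scale1r mul1r /h fmU.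
  by rewrite big_seq1.
- have e_mul : {morph e : x y / x * y} * (e 1 = 1).
    (* Multiplicativity of [mmap] requires the images of scalars to commute with the values of [h];
       in an algebra, scalars are central. *)
    apply: commr_mmap_is_multiplicative => g m m'.
    by rewrite /GRing.comm /= -scalerAl -scalerAr mul1r mulr1.
  by split; case: e_mul.
- by move=> c x y; rewrite /e mmapD mmapZ /= -scalerAl mul1r.
Qed.

End FreeAlgebraUniversal.

Section QuotientUniversal.
Variables (K : fieldType) (A B : algType K) (S : relators A).

Lemma alg_quot_ext (f g : {lrmorphism alg_quot S -> B}) :
  (forall x, f (quot_proj S x) = g (quot_proj S x)) -> f =1 g.
Proof. by move=> fg x; have [y <-] := quot_proj_surj x. Qed.

Lemma alg_quot_lift (f : {lrmorphism A -> B}) :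
    (forall x, relset S x -> f x = 0) ->
  exists g : {lrmorphism alg_quot S -> B}, forall x, g (quot_proj S x) = f x.
Proof.
move=> fS.
(* The kernel of [f] is a two-sided ideal containing the relators, hence contains the ideal they
   generate. *)
have f_ideal x : ideal_gen S x -> f x = 0.
  move=> /(_ [set y | f y = 0]%classic); apply; split=> [|y /fS //].
  split=> [|y z /= fy fz|a y b /= fy] /=; first exact: linear0.
    by rewrite linearD /= fy fz addr0.
  by rewrite !rmorphM /= fy mulr0 mul0r.
(* [g] evaluates [f] at a chosen preimage; [gE] shows that the choice is immaterial. *)
pose g (x : alg_quot S) := f (projT1 (cid (quot_proj_surj x))).
have gE x : g (quot_proj S x) = f x.
  rewrite /g; case: cid => y /= yE; apply/eqP; rewrite -subr_eq0 -linearB.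
  by apply/eqP/f_ideal/quot_proj_eq0; rewrite linearB /= yE subrr.
have [||g' gg] := @exists_lrmorphism _ _ _ g; last first.
- by exists g' => x; rewrite -gg gE.
- split=> [|x y]; first by rewrite -(rmorph1 (quot_proj S)) gE rmorph1.
  have [x' <-] := quot_proj_surj x; have [y' <-] := quot_proj_surj y.
  by rewrite -rmorphM !gE rmorphM.
- move=> c x y.
  have [x' <-] := quot_proj_surj x; have [y' <-] := quot_proj_surj y.
  by rewrite -linearP !gE linearP.
Qed.

End QuotientUniversal.

(** * Formal series and their images under morphisms *)

Section SeriesAlgebra.
Variables (K : numFieldType) (A : algType K).
Implicit Types (x y z : nat -> A) (f g : nat -> K).

(** Truncation at [n] leaves the coefficients below [n] unchanged, so associativity can be imported
    from polynomials over [A]. *)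
Let coef_ser_mul x y m n : (m < n)%N ->
  ser_mul x y m = ((\poly_(i < n) x i) * (\poly_(i < n) y i))`_m.
Proof.
move=> mn; rewrite coefM; apply: eq_bigr => i _; rewrite !coef_poly.
by rewrite !(leq_ltn_trans _ mn) ?leq_subr // -ltnS.
Qed.

Lemma eq_ser_mul x x' y y' n :
  x =1 x' -> y =1 y' -> ser_mul x y n = ser_mul x' y' n.
Proof. by move=> xx' yy'; apply: eq_bigr => i _; rewrite xx' yy'. Qed.

Lemma ser_mulA x y z n :
  ser_mul x (ser_mul y z) n = ser_mul (ser_mul x y) z n.
Proof.
pose p w := \poly_(i < n.+1) (w i : A).
transitivity ((p x * (p y * p z))`_n).
  rewrite coefM; apply: eq_bigr => i _.
  by rewrite coef_poly ltn_ord (@coef_ser_mul _ _ _ n.+1) // ltnS leq_subr.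
rewrite mulrA coefM; apply: eq_bigr => i _.
by rewrite (@coef_ser_mul _ _ _ n.+1) // coef_poly ltnS leq_subr.
Qed.

Lemma ser_mulC x y n :
  (forall k l, x k * y l = y l * x k) -> ser_mul x y n = ser_mul y x n.
Proof.
move=> xy; rewrite /ser_mul (reindex_inj rev_ord_inj) /=.
by apply: eq_bigr => i _; rewrite xy subSS subKn // -ltnS.
Qed.

Lemma ser_scaleE f x n : ser_scale f x n = ser_mul (fun k => (f k)%:A) x n.
Proof. by apply: eq_bigr => i _; rewrite -scalerAl mul1r. Qed.

Lemma ser_scale_mulr f x y n :
  ser_mul x (ser_scale f y) n = ser_scale f (ser_mul x y) n.
Proof.
rewrite ser_scaleE ser_mulA (eq_ser_mul _ (frefl x) (ser_scaleE f y)) ser_mulA.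
apply: eq_ser_mul => // k; apply: ser_mulC => i j.
by rewrite -scalerAr -scalerAl mulr1 mul1r.
Qed.

(** The regular algebra [K^o] lets [ser_mul] multiply scalar series. *)
Lemma ser_scaleA f g x n :
  ser_scale f (ser_scale g x) n = ser_scale (ser_mul (f : nat -> K^o) g) x n.
Proof.
rewrite !ser_scaleE (eq_ser_mul _ (frefl _) (ser_scaleE g x)) ser_mulA.
apply: eq_ser_mul => // k; rewrite /ser_mul scaler_suml.
by apply: eq_bigr => i _; rewrite -scalerAl mul1r scalerA.
Qed.

Lemma ser_scale1 f x n :
  (forall k, f k = (k == 0%N)%:R) -> ser_scale f x n = x n.
Proof.
move=> f1; rewrite /ser_scale big_ord_recl big1 => [|i _].
  by rewrite f1 scale1r subn0 addr0.
by rewrite f1 scale0r.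
Qed.

Lemma ser_scaleZ f c x n :
  ser_scale f (fun k => c *: x k) n = c *: ser_scale f x n.
Proof.
rewrite /ser_scale scaler_sumr; apply: eq_bigr => i _.
by rewrite !scalerA mulrC.
Qed.

Lemma eq_ser_scale f x y n : x =1 y -> ser_scale f x n = ser_scale f y n.
Proof. by move=> xy; apply: eq_bigr => i _; rewrite xy. Qed.

End SeriesAlgebra.

Section SeriesMorphism.
Variables (K : numFieldType) (A B : algType K) (h : {lrmorphism A -> B}).

Lemma rmorph_ser_mul x y n :
  h (ser_mul x y n) = ser_mul (fun k => h (x k)) (fun k => h (y k)) n.
Proof. by rewrite rmorph_sum; apply: eq_bigr => i _; rewrite rmorphM. Qed.

Lemma linear_ser_scale f x n :
  h (ser_scale f x n) = ser_scale f (fun k => h (x k)) n.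
Proof. by rewrite linear_sum; apply: eq_bigr => i _; rewrite linearZ. Qed.

Lemma rmorph_ucoef x a : h (ucoef x a) = ucoef (fun k => h (x k)) a.
Proof. by rewrite /ucoef; case: ifP => _; rewrite ?rmorph0. Qed.

Lemma rmorph_gen_ser (I : finType) (x : I * I * nat -> A) i j n :
  h (gen_ser x i j n) = gen_ser (fun q => h (x q)) i j n.
Proof. by case: n => [|n] //=; rewrite rmorph_nat. Qed.

Lemma rmorph_gl2_relator (T : 'I_2 -> 'I_2 -> nat -> A) i j k l a b :
  h (gl2_relator T i j k l a b) =
  gl2_relator (fun i j n => h (T i j n)) i j k l a b.
Proof.
rewrite /gl2_relator /uvmul /uvcomm /uvexch !scale0r !subr0.
rewrite !rmorphB !rmorphM /= !rmorph_ucoef.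

done.
Qed.

End SeriesMorphism.

(** * Effect of T(u) |-> f(u) T(u) on the relators of Y(gl_2) *)

Section RelatorScaling.
Variables (K : numFieldType) (A : algType K) (f : nat -> K).

(** Terms with a + p > 0 vanish, so any bound above |a| will do; one [N] can then serve several
    exponents at once. *)
Lemma ucoef_scale (x : nat -> A) a N : (`|a| < N)%N ->
  ucoef (ser_scale f x) a = \sum_(p < N) f p *: ucoef x (a + p%:Z).
Proof.
move=> aN; rewrite /ucoef; have [a0|a0] := lerP a 0; last first.
  rewrite big1 // => p _; rewrite leNgt ltr_wpDr //= scaler0 //.
rewrite /ser_scale (big_ord_widen N (fun k => f k *: x (`|a| - k)%N)) //.
rewrite big_mkcond /=; apply: eq_bigr => p _.
have -> : a = - `|a|%N%:Z by rewrite abszE ler0_norm // opprK.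
rewrite abszN absz_nat ltnS addrC subr_le0 lez_nat.
case: ifP => pa; last by rewrite scaler0.
by rewrite distnC distnEl.
Qed.

(** The coefficient of u^a v^b in f(u) f(v) G(u, v), with exponent shifts cut off at [N]. *)
Let scale2 N (G : int -> int -> A) a b :=
  \sum_(p < N) \sum_(q < N) (f p * f q) *: G (a + p%:Z) (b + q%:Z).

Let scale2M N (x y : nat -> A) a b : (`|a| < N)%N -> (`|b| < N)%N ->
  ucoef (ser_scale f x) a * ucoef (ser_scale f y) b =
  scale2 N (fun a b => ucoef x a * ucoef y b) a b.
Proof.
move=> aN bN; rewrite !(ucoef_scale _ aN, ucoef_scale _ bN) mulr_suml.
apply: eq_bigr => p _; rewrite mulr_sumr; apply: eq_bigr => q _.
by rewrite -scalerAl -scalerAr scalerA.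
Qed.

(** For the second half of a commutator: the order y(v) x(u) is kept, and only the scalars [f p] and
    [f q] are exchanged. *)
Let scale2M' N (x y : nat -> A) a b : (`|a| < N)%N -> (`|b| < N)%N ->
  ucoef (ser_scale f y) b * ucoef (ser_scale f x) a =
  scale2 N (fun a b => ucoef y b * ucoef x a) a b.
Proof.
move=> aN bN; rewrite (scale2M _ _ bN aN) /scale2 exchange_big /=.
by apply: eq_bigr => p _; apply: eq_bigr => q _; rewrite mulrC.
Qed.

Let scale2B N G H a b :
  scale2 N (fun a b => G a b - H a b) a b = scale2 N G a b - scale2 N H a b.
Proof.
rewrite /scale2 -sumrB; apply: eq_bigr => p _; rewrite -sumrB.
by apply: eq_bigr => q _; rewrite scalerBr.
Qed.

Let scale2_shiftl N G a b :
  scale2 N G (a - 1) b = scale2 N (fun a b => G (a - 1) b) a b.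
Proof. by apply: eq_bigr => p _; apply: eq_bigr => q _; rewrite addrAC. Qed.

Let scale2_shiftr N G a b :
  scale2 N G a (b - 1) = scale2 N (fun a b => G a (b - 1)) a b.
Proof.
by apply: eq_bigr => p _; apply: eq_bigr => q _; rewrite [b - 1 + _]addrAC.
Qed.

(** Every product in the relation has one factor in u and one in v, so the whole relator is
    multiplied by f(u) f(v). *)
Lemma gl2_relator_scale (T : 'I_2 -> 'I_2 -> nat -> A) i j k l a b :
    (forall a b, gl2_relator T i j k l a b = 0) ->
  gl2_relator (fun i j => ser_scale f (T i j)) i j k l a b = 0.
Proof.
(* The summand 2 keeps the shifted exponents a - 1 and b - 1 within the bound too. *)
move=> rel0; pose N := (`|a| + `|b| + 2)%N.
have [aN bN] : (`|a| < N)%N /\ (`|b| < N)%N by rewrite /N; lia.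
have [a1N b1N] : (`|(a - 1)%R| < N)%N /\ (`|(b - 1)%R| < N)%N.
  by rewrite /N; lia.
transitivity (scale2 N (gl2_relator T i j k l) a b); last first.
  rewrite /scale2 big1 // => p _; rewrite big1 // => q _.
  by rewrite rel0 scaler0.
have -> : gl2_relator T i j k l = fun a b =>
    uvcomm (T i j) (T k l) (a - 1) b - uvcomm (T i j) (T k l) a (b - 1)
    - uvexch (T k j) (T i l) a b.
  apply/funext => c; apply/funext => d.
  by rewrite /gl2_relator /uvmul scale0r subr0.
rewrite 2!scale2B -(scale2_shiftl N (uvcomm _ _)).
rewrite -(scale2_shiftr N (uvcomm _ _)).
rewrite !scale2B.
rewrite /gl2_relator /uvmul /uvcomm /uvexch scale0r subr0.
by rewrite !(scale2M _ _ a1N bN, scale2M' _ _ a1N bN, scale2M _ _ aN b1N,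
  scale2M' _ _ aN b1N, scale2M _ _ aN bN, scale2M' _ _ aN bN).
Qed.

End RelatorScaling.

(** * Scaling automorphisms of Y(gl_2) *)

Section YangianScaling.
Variable K : numFieldType.

Let gl2_proj : {lrmorphism gl2_free K -> Ygl2 K} := quot_proj (gl2_relators K).

Let gl2_projE i j r : gl2_proj (gen_ser (@free_gen K _) i j r) = Tser K i j r.
Proof. exact: rmorph_gen_ser. Qed.

Lemma Tser_relation i j k l a b : gl2_relator (Tser K) i j k l a b = 0.
Proof.
have : gl2_proj (gl2_relator (gen_ser (@free_gen K _)) i j k l a b) = 0.
  by apply/quot_proj_eq0 => J [_]; apply; exists i, j, k, l, a, b.
rewrite rmorph_gl2_relator => <-; congr (gl2_relator _ i j k l a b).
by apply/funext => i'; apply/funext => j'; apply/funext => n; rewrite gl2_projE.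
Qed.

Lemma Ygl2_ext (A : algType K) (f g : {lrmorphism Ygl2 K -> A}) :
  (forall i j r, f (Tser K i j r) = g (Tser K i j r)) -> f =1 g.
Proof.
move=> fg; apply: alg_quot_ext.
apply: (@free_alg_ext _ _ _ (f \o quot_proj _) (g \o quot_proj _)).
(* The free generator with index [r] is the coefficient number [r.+1] of its series. *)
by move=> [[i j] r]; apply: (fg i j r.+1).
Qed.

Lemma Xo4_ext (A : algType K) (f g : {lrmorphism Xo4 K -> A}) :
  (forall a b r, f (tser K a b r) = g (tser K a b r)) -> f =1 g.
Proof.
move=> fg; apply: alg_quot_ext.
apply: (@free_alg_ext _ _ _ (f \o quot_proj _) (g \o quot_proj _)).
by move=> [[i j] r]; apply: (fg i j r.+1).
Qed.

Lemma Ygl2_scaling (f : nat -> K) : f 0%N = 1 ->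
  exists m : {lrmorphism Ygl2 K -> Ygl2 K},
    forall i j r, m (Tser K i j r) = ser_scale f (Tser K i j) r.
Proof.
move=> f0.
have [v vE] := @free_alg_lift K _ (Ygl2 K)
  (fun q => ser_scale f (Tser K q.1.1 q.1.2) q.2.+1).
have vT i j r : v (gen_ser (@free_gen K _) i j r) = ser_scale f (Tser K i j) r.
  (* The constant term is no generator: it stays delta_ij because [f 0 = 1]. *)
  rewrite rmorph_gen_ser; case: r => [|r] /=; last by rewrite vE.
  by rewrite /ser_scale big_ord1 f0 scale1r.
have [|m mE] := @alg_quot_lift K _ (Ygl2 K) (gl2_relators K) v.
  move=> _ [i [j [k [l [a [b ->]]]]]]; rewrite rmorph_gl2_relator.
  rewrite -[RHS](gl2_relator_scale f a b (Tser_relation i j k l)).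
  congr (gl2_relator _ i j k l a b).
  by apply/funext => i'; apply/funext => j'; apply/funext => n; rewrite vT.
exists m => i j r; rewrite -vT -mE; congr (m _).
by rewrite rmorph_gen_ser.
Qed.

(** The inverse is the scaling by the inverse series of [f]; both composites fix the generators. *)
Lemma Ygl2_scaling_automorphism (f : nat -> K) : f 0%N = 1 ->
  exists2 m : {lrmorphism Ygl2 K -> Ygl2 K},
    scaling_automorphism (Tser K) m &
    forall i j r, m (Tser K i j r) = ser_scale f (Tser K i j) r.
Proof.
move=> f0; pose g : nat -> K := ser_inv (f : nat -> K^o).
have gf n : ser_mul (g : nat -> K^o) f n = (n == 0%N)%:R.
  exact: (ser_mulVx (f0 : (f : nat -> K^o) 0%N = 1)).
have g0 : g 0%N = 1 by have := gf 0%N; rewrite /ser_mul big_ord1 f0 mulr1.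
have [m mE] := Ygl2_scaling f0; have [m' m'E] := Ygl2_scaling g0.
exists m => //; split; last by exists f.
have comp_id f1 f2 (m1 m2 : {lrmorphism Ygl2 K -> Ygl2 K}) :
    (forall i j r, m1 (Tser K i j r) = ser_scale f1 (Tser K i j) r) ->
    (forall i j r, m2 (Tser K i j r) = ser_scale f2 (Tser K i j) r) ->
    (forall n, ser_mul (f2 : nat -> K^o) f1 n = (n == 0%N)%:R) ->
    cancel m2 m1.
  move=> m1E m2E f21; apply: (@Ygl2_ext _ (m1 \o m2) idfun) => i j r /=.
  rewrite m2E linear_ser_scale (eq_ser_scale _ _ (m1E i j)) ser_scaleA.
  exact: ser_scale1.
exists m'; last exact: (comp_id _ _ _ _ mE m'E).
(* [gf] gives g f = 1 only; the other order follows from commutativity of [K]. *)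
apply: (comp_id _ _ _ _ m'E mE) => n; rewrite ser_mulC ?gf // => k l.
exact: mulrC.
Qed.

End YangianScaling.

(** * Restricting an isomorphism onto A (x) Y(gl_2) to Y(o_4) *)

Section RestrictionToFixed.
Variables (K : numFieldType) (A : algType K).
Variables (chi : {lrmorphism Xo4 K -> tensor A (Ygl2 K)}).
Hypothesis chi_bij : bijective chi.
Variables (c : o4idx -> o4idx -> K) (x : o4idx -> o4idx -> nat -> A).
Variables (u v : o4idx -> o4idx -> 'I_2).
Hypothesis chiE : forall a b r, chi (tser K a b r) = c a b *:
  ser_mul (fun n => tens (x a b n) 1)
          (fun n => tens 1 (Tser K (u a b) (v a b) n)) r.

(** [beta] affects only the right-hand series, and the factor f(u) it produces moves to the front
    because scalars are central. *)
Let chi_scale (f : nat -> K) (beta : {lrmorphism Ygl2 K -> Ygl2 K}) :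
    (forall i j r, beta (Tser K i j r) = ser_scale f (Tser K i j) r) ->
  forall a b r, tensor_map idfun beta (chi (tser K a b r)) =
                chi (ser_scale f (tser K a b) r).
Proof.
move=> betaE a b r; rewrite linear_ser_scale (eq_ser_scale _ _ (chiE a b)).
rewrite ser_scaleZ chiE linearZ /=; congr (_ *: _).
rewrite (rmorph_ser_mul (tensor_map idfun beta)) /= -ser_scale_mulr.
apply: eq_ser_mul => n /=; rewrite tensor_map_tens ?rmorph1 //.
rewrite betaE /ser_scale tens_sumr; apply: eq_bigr => k _.
by rewrite tensZr.
Qed.

(** The arbitrary left factor [A] and index maps [u], [v] let this serve both for [chi1] and for
    [chi2] followed by the swap. *)
Lemma Yo4_restriction :
  exists phi : {lrmorphism Yo4 K -> tensor A (Ysl2 K)},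
    bijective phi /\
    forall y, tensor_map idfun (Ysl2_incl K) (phi y) = chi (Yo4_incl K y).
Proof.
pose incl := tensor_map (idfun : {lrmorphism A -> A}) (Ysl2_incl K).
have incl_inj : injective incl.
  by apply: tensor_idmap_inj; apply: val_inj.
have [chi' chiK chi'K] := lrmorphism_inverse chi_bij.
have [|phi phiE] := @lrmorphism_factor _ _ _ _ _ (chi \o Yo4_incl K) incl_inj.
  case=> y /= y_fix; apply: tensor_fixed => beta [beta_bij [f [f0 betaE]]].
  (* Conjugation by [chi] turns [beta] into a scaling automorphism of X(o_4), which fixes [y] by
     definition of Y(o_4). *)
  pose alpha : {lrmorphism Xo4 K -> Xo4 K} :=
    chi' \o (tensor_map idfun beta \o chi).
  have alpha_scaling : scaling_automorphism (tser K) alpha.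
    split; last first.
      by exists f; split=> // a b r; rewrite /= (chi_scale betaE) chiK.
    apply: bij_comp; first by exists chi.
    by apply: bij_comp => //; apply: tensor_idmap_bij.
  have /asboolP/(_ _ alpha_scaling) yE := y_fix.
  by rewrite -[RHS](congr1 chi yE) /= chi'K.
exists phi; split=> //.
have phi_inj : injective phi.
  move=> y y' /(congr1 incl); rewrite /incl !phiE /=.
  by move/(can_inj chiK)/val_inj.
have phi_surj z : exists y, phi y = z.
  (* Conversely, an automorphism of X(o_4) scaling by [f] corresponds to the one of Y(gl_2) with the
     same [f], which fixes the right factors of [incl z]. *)
  have z_fix : chi' (incl z) \in fixed (scaling_automorphism (tser K)).
    apply/asboolP => alpha [_ [f [f0 alphaE]]].
    have [beta beta_scaling betaE] := Ygl2_scaling_automorphism f0.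
    have chi_alpha : chi \o alpha =1 tensor_map idfun beta \o chi.
      by apply: Xo4_ext => a b r; rewrite /= alphaE (chi_scale betaE).
    apply: (can_inj chiK); rewrite [LHS]chi_alpha /= chi'K.
    rewrite /incl; elim/tensor_ind: z => [|a [b b_fix] z IHz].
      by rewrite !linear0.
    rewrite !linearD /= IHz !tensor_map_tens /=; congr (tens _ _ + _).
    by move/asboolP: b_fix; apply.
  exists (FixedAlg z_fix); apply: incl_inj; rewrite [LHS]phiE /=.
  exact: chi'K.
exists (fun z => projT1 (cid (phi_surj z))) => [y|z]; case: cid => //= y'.
exact: phi_inj.
Qed.

End RestrictionToFixed.

Theorem corollary4p11 (R : realType)
    (psi : {lrmorphism Xo4 R[i] -> tensor (Ygl2 R[i]) (Ygl2 R[i])})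
    (pr : {lrmorphism Ygl2 R[i] -> Ysl2 R[i]})
    (psiE : is_psi psi) (psi_inj : injective psi) (prE : is_projection pr)
    (chi1 : {lrmorphism Xo4 R[i] -> tensor (Ysl2 R[i]) (Ygl2 R[i])})
    (chi2 : {lrmorphism Xo4 R[i] -> tensor (Ygl2 R[i]) (Ysl2 R[i])})
    (chi1E : forall x, chi1 x = tensor_map pr idfun (psi x))
    (chi2E : forall x, chi2 x = tensor_map idfun pr (psi x))
    (chi1_bij : bijective chi1) (chi2_bij : bijective chi2) :
  (exists phi1 : {lrmorphism Yo4 R[i] -> tensor (Ysl2 R[i]) (Ysl2 R[i])},
     bijective phi1 /\
     forall y, tensor_map idfun (Ysl2_incl R[i]) (phi1 y) =
               chi1 (Yo4_incl R[i] y)) /\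
  (exists phi2 : {lrmorphism Yo4 R[i] -> tensor (Ysl2 R[i]) (Ysl2 R[i])},
     bijective phi2 /\
     forall y, tensor_map (Ysl2_incl R[i]) idfun (phi2 y) =
               chi2 (Yo4_incl R[i] y)).

Proof.
split.
  apply: (@Yo4_restriction _ _ chi1 chi1_bij (fun a b => o4eps _ a * o4eps _ b)
    (fun a b r => pr (Tser _ (o4pair a).1 (o4pair b).1 r))
    (fun a b => (o4pair a).2) (fun a b => (o4pair b).2)) => a b r.
  rewrite chi1E psiE linearZ /=; congr (_ *: _).
  rewrite (rmorph_ser_mul (tensor_map pr idfun)).
  by apply: eq_ser_mul => n; rewrite /= tensor_map_tens ?rmorph1.
have [s sE] := exists_tensor_swap (Ygl2 R[i]) (Ysl2 R[i]).
have [s' s'E] := exists_tensor_swap (Ysl2 R[i]) (Ygl2 R[i]).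
have [t tE] := exists_tensor_swap (Ysl2 R[i]) (Ysl2 R[i]).
have tK : cancel t t.
  by elim/tensor_ind => [|a b z IHz]; rewrite ?linear0 // !linearD /= IHz !tE.
have sK : cancel s s'.
  elim/tensor_ind => [|a b z IHz]; first by rewrite !linear0.
  by rewrite !linearD /= IHz sE s'E.
have s'K : cancel s' s.
  elim/tensor_ind => [|a b z IHz]; first by rewrite !linear0.
  by rewrite !linearD /= IHz s'E sE.
(* After the swap, the second indices belong to the projected left factor and the first ones to
   Y(gl_2). *)
have [||phi [phi_bij phiE]] := (@Yo4_restriction _ _ (s \o chi2) _
    (fun a b => o4eps _ a * o4eps _ b)
    (fun a b r => pr (Tser _ (o4pair a).2 (o4pair b).2 r))
    (fun a b => (o4pair a).1) (fun a b => (o4pair b).1)).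
- by apply: bij_comp => //; exists s'.
- move=> a b r; rewrite /= chi2E psiE !linearZ /=; congr (_ *: _).
  rewrite (rmorph_ser_mul (tensor_map idfun pr)) rmorph_ser_mul.
  (* The swap reverses the two series in the product; their coefficients commute, being of the forms
     1 (x) b and a (x) 1. *)
  rewrite ser_mulC => [|k l].
    by apply: eq_ser_mul => n; rewrite /= tensor_map_tens ?rmorph1 sE.
  by rewrite /= !tensor_map_tens !rmorph1 !sE !tensM !mul1r !mulr1.
(* [phi] has the two factors in swapped order; [t] puts them back. *)
exists (t \o phi); split=> [|y]; first by apply: bij_comp => //; exists t.
rewrite -[RHS]sK -[s _]/((s \o chi2) _) -phiE /=.
(* What remains is that the swaps intertwine the inclusion on the left with the one on the right,
   which is checked on pure tensors. *)
elim/tensor_ind: (phi y) => [|a b z IHz]; first by rewrite !linear0.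
by rewrite !linearD /= IHz tE !tensor_map_tens s'E.
Qed.
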